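(* For every $p \in [1,2)$ there exists a constant $K_p$, depending only on $p$, such that the following holds. Let $N$ be a simple counting process with mean function $F(s) = \operatorname{E}(N(s))$, $s \in [0,\infty]$, and for each $n \in \mathbb{N}$ let $F_n = n^{-1}\sum_{i=1}^n N_i$ be the average of independent replications $N_1, \dots, N_n$ of $N$ (i.e. independent processes with the same distribution as $N$). Then $$\operatorname{E}\big(\|F_n - F\|_{[p]}\big) \leq K_p\, F(\infty)^{\frac{1}{p}}\, n^{\frac{1-p}{p}}$$ for every $n \in \mathbb{N}$.
   Context: A counting process $N$ is a stochastic process indexed by $[0,\infty]$ (each $N(s)$ is a random variable) whose paths take only non-negative integer values, are increasing ($N(t) \ge N(s)$ for $t \ge s$), are right-continuous with left limits, and satisfy $N(0)=0$ and $N(\infty) = \lim_{t\to\infty} N(t)$. It is called simple if it is no larger than $1$. For $p \ge 1$ and a real function $f$ on $J = [0,\infty)$, the $p$-variation is $v_p(f) = \sup \sum_{j=1}^m |f(t_j) - f(t_{j-1})|^p$, the supremum being over all $m \in \mathbb{N}$ and all $t_0 < t_1 < \dots < t_m$ in $J$. Put $\|f\|_{(p)} = v_p(f)^{1/p}$, $\|f\|_\infty = \sup_{t \in J}|f(t)|$, and $\|f\|_{[p]} = \|f\|_{(p)} + \|f\|_\infty$ (the $p$-variation norm). *)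

(* Defs.v *)
From HB Require Import structures.
From mathcomp Require Import all_boot all_order all_algebra.
From mathcomp Require Import all_classical all_reals all_analysis.

Set Implicit Arguments.
Unset Strict Implicit.
Unset Printing Implicit Defensive.

Import Order.TTheory GRing.Theory Num.Theory.
Import numFieldNormedType.Exports.

Local Open Scope classical_set_scope.
Local Open Scope ring_scope.

(* Processes are indexed by [0, +oo], encoded inside [\bar R]: no definition
   below looks at an index [s] with [s < 0]. *)
Definition process d (T : measurableType d) (R : realType)
  (P : probability T R) : Type := \bar R -> {RV P >-> R}.

Definition path d (T : measurableType d) (R : realType)
  (P : probability T R) (N : process P) (w : T) : \bar R -> R :=
  fun s => N s w.

Record is_counting_path (R : realType) (x : \bar R -> R) : Prop := {
  counting_nat : forall s, (0 <= s)%E -> exists k : nat, x s = k%:R;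
  counting_incr : forall s t, (0 <= s)%E -> (s <= t)%E -> x s <= x t;
  counting_rcont : forall t : R, 0 <= t ->
    x u%:E @[u --> t^'+] --> x t%:E;
  counting_llim : forall t : R, 0 < t ->
    exists l : R, x u%:E @[u --> t^'-] --> l;
  counting_0 : x 0%E = 0;
  counting_oo : x u%:E @[u --> +oo] --> x +oo%E
}.

Definition counting_process d (T : measurableType d) (R : realType)
  (P : probability T R) (N : process P) : Prop :=
  forall w, is_counting_path (path N w).

Definition simple_process d (T : measurableType d) (R : realType)
  (P : probability T R) (N : process P) : Prop :=
  forall s w, (0 <= s)%E -> N s w <= 1.

(* One-dimensional cylinders at indices in [0, +oo]; they generate the product
   sigma-algebra on paths, with respect to which laws and independence of
   processes are defined. *)
Definition cylinders (R : realType) : set (set (\bar R -> R)) :=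
  [set A | exists (s : \bar R) (B : set R),
     [/\ (0 <= s)%E, measurable B & A = [set x | B (x s)]]].

Definition same_law (R : realType)
  d (T : measurableType d) (P : probability T R) (N : process P)
  d' (T' : measurableType d') (P' : probability T' R) (N' : process P') : Prop :=
  forall A, <<s @cylinders R >> A -> P (path N @^-1` A) = P' (path N' @^-1` A).

(* The product rule over proper subfamilies is the case where the remaining
   [A i] are [setT]. *)
Definition independent_processes (R : realType)
  d (T : measurableType d) (P : probability T R) (n : nat)
  (Ns : 'I_n -> process P) : Prop :=
  forall A : 'I_n -> set (\bar R -> R),
    (forall i, <<s @cylinders R >> (A i)) ->
    P (\bigcap_(i in setT) (path (Ns i) @^-1` A i))
    = (\prod_(i < n) P (path (Ns i) @^-1` A i))%E.

(* For a simple counting process the expectation is finite, so that [fine]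
   loses nothing. *)
Definition mean_fun d (T : measurableType d) (R : realType)
  (P : probability T R) (N : process P) (s : \bar R) : R :=
  fine ('E_P[N s])%E.

Definition empirical_mean d (T : measurableType d) (R : realType)
  (P : probability T R) (n : nat) (Ns : 'I_n -> process P)
  (s : \bar R) (w : T) : R :=
  n%:R^-1 * \sum_(i < n) Ns i s w.

(* Functions on [0, +oo[ are given as functions on [R], only evaluated on
   nonnegative arguments. *)
Definition pvariation (R : realType) (p : R) (f : R -> R) : \bar R :=
  ereal_sup [set S | exists (m : nat) (t : nat -> R),
    [/\ 0 <= t 0%N, (forall j, (j < m)%N -> t j < t j.+1) &
        S = (\sum_(j < m) `|f (t j.+1) - f (t j)| `^ p)%:E]].

Definition pvar_seminorm (R : realType) (p : R) (f : R -> R) : \bar R :=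
  poweR (pvariation p f) p^-1.

Definition sup_norm (R : realType) (f : R -> R) : \bar R :=
  ereal_sup [set (`|f t|)%:E | t in [set t | 0 <= t]].

Definition pvar_norm (R : realType) (p : R) (f : R -> R) : \bar R :=
  (pvar_seminorm p f + sup_norm f)%E.

(* Main.v *)
Require Import Defs.
From HB Require Import structures.
From mathcomp Require Import all_boot all_order all_algebra.
From mathcomp Require Import all_classical all_reals all_analysis.
From mathcomp Require Import measurable_realfun.
From mathcomp Require Import ring lra zify.

Set Implicit Arguments.
Unset Strict Implicit.
Unset Printing Implicit Defensive.

Import Order.TTheory GRing.Theory Num.Theory.
Import numFieldNormedType.Exports.

Local Open Scope classical_set_scope.
Local Open Scope ring_scope.

(** Write [f = F_n - F]. Since [f 0 = 0], a single step from time 0 shows that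
    the sup norm is at most the p-variation seminorm, so only the latter needs
    a bound, and by concavity of the p-th root the right size for it is
    [(n * F(oo) * n^(-p))^(1/p)]: about [n * F(oo)] jumps of size [1 / n].

    Cut the time axis into cells, at the times where [n * F] crosses an integer
    ([quantile_cuts]). An increment of [f] between two times of one cell is
    controlled by the total variation of [f] over that cell, which comes from
    the number of jumps of the copies there plus its mean. That mean is at most
    1, so for [z], which is [n] times this variation, the bound
    [z^p <= z + z^2] costs only a constant factor in expectation, and the
    contributions of all cells add up to at most [7 F(oo) n^(1-p)].

    An increment between two different cells is, up to the total variation over
    these cells, an increment of the values [y j] at the left ends of the cells.
    There are at most [n * F(oo) + 1] cells, and a dyadic argument bounds the
    p-variation of [y]: rounding the partition points down to even numbers
    costs twice the l^p norm of the increments [y (2 b + 1) - y (2 b)], and then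
    the procedure is repeated on [y (2 b)] ([dyadic_chaining]). Each increment
    of [n * y] is a centred count of pairwise independent events, so its second
    moment is at most its mass; as [p < 2], the inequality
    [|x|^p <= c^(p-2) x^2 + c^p] with [c = 2^(k/2)] bounds the mean of the sum
    of the p-th powers at scale [2^k] by [2 F(oo) n^(1-p) 2^(-k(1-p/2))]. The
    p-th roots of these bounds form a geometric series, dominated by the finest
    scale.

    Minkowski's inequality for finite sums puts the pieces together
    ([variation_sum_le], [pvar_norm_le]). To avoid p-th roots of random
    quantities, a sum [V] of p-th powers whose mean is of order [alpha^p] is
    bounded by [(alpha * (1 + V / alpha^p))^p] ([powR_le_linear]), whose p-th
    root is linear in [V]. What remains is the mean of a finite combination of
    counts and squares of counts. *)

(** * Minkowski's inequality for finite sums *)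

Lemma powR_convex2 (R : realType) (p l x y : R) :
  1 <= p -> 0 <= l <= 1 -> 0 <= x -> 0 <= y ->
  (l * x + (1 - l) * y) `^ p <= l * x `^ p + (1 - l) * y `^ p.
Proof.
move=> p1 /andP[l0 l1] x0 y0.
have := @convex_powR R p p1 (Itv01 l0 l1) x y.
by rewrite !inE /= !in_itv /= !andbT !convRE /=; exact.
Qed.

Lemma powR_div (R : realType) (p x y : R) :
  0 <= x -> 0 <= y -> (x / y) `^ p = x `^ p / y `^ p.
Proof.
move=> x0 y0; rewrite powRM ?invr_ge0//; congr (_ * _).
by rewrite -(powR_inv1 y0) powRAC powR_inv1 ?powR_ge0.
Qed.

(** After division by [A + B] this is the convexity of the p-th power. Bounds
    [A] and [B] on the norms replace the norms themselves, so that no p-th root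
    is taken. *)
Lemma minkowski_sum (R : realType) (p : R) (r : nat) (a b : nat -> R) (A B : R) :
  1 <= p -> (forall i, 0 <= a i) -> (forall i, 0 <= b i) -> 0 <= A -> 0 <= B ->
  \sum_(i < r) a i `^ p <= A `^ p -> \sum_(i < r) b i `^ p <= B `^ p ->
  \sum_(i < r) (a i + b i) `^ p <= (A + B) `^ p.
Proof.
move=> p1 a0 b0 A0 B0 hA hB.
have p0 : p != 0 by rewrite gt_eqF// (lt_le_trans _ p1).
have zero (c : nat -> R) : (forall i, 0 <= c i) ->
    \sum_(i < r) c i `^ p <= 0 `^ p -> forall i : 'I_r, c i = 0.
  move=> c0; rewrite powR0// => h i.
  have /eqP : \sum_(i < r) c i `^ p = 0.
    by apply/eqP; rewrite eq_le h sumr_ge0// => j _; exact: powR_ge0.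
  rewrite psumr_eq0; last by move=> j _; exact: powR_ge0.
  by move=> /allP/(_ i (mem_index_enum _))/eqP/powR_eq0_eq0.
have [A00|A_neq0] := eqVneq A 0.
  rewrite A00 in hA *; rewrite add0r (le_trans _ hB)// le_eqVlt; apply/orP; left.
  by apply/eqP/eq_bigr => i _; rewrite (zero a)// add0r.
have [B00|B_neq0] := eqVneq B 0.
  rewrite B00 in hB *; rewrite addr0 (le_trans _ hA)// le_eqVlt; apply/orP; left.
  by apply/eqP/eq_bigr => i _; rewrite (zero b)// addr0.
have A_gt0 : 0 < A by rewrite lt_def A_neq0.
have B_gt0 : 0 < B by rewrite lt_def B_neq0.
have AB_gt0 : 0 < A + B by rewrite addr_gt0.
pose l := A / (A + B).
have l1 : 1 - l = B / (A + B) by rewrite /l; field; rewrite gt_eqF.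
have l01 : 0 <= l <= 1.
  by rewrite /l divr_ge0 ?(ltW AB_gt0)//= ler_pdivrMr// mul1r lerDl.
have term i : (a i + b i) `^ p <=
    (A + B) `^ p * (l * (a i `^ p / A `^ p) + (1 - l) * (b i `^ p / B `^ p)).
  have -> : a i + b i = (A + B) * (l * (a i / A) + (1 - l) * (b i / B)).
    by rewrite l1 /l; field; rewrite !gt_eqF.
  have aA : 0 <= a i / A by rewrite divr_ge0.
  have bB : 0 <= b i / B by rewrite divr_ge0.
  case/andP: (l01) => l0 l1'.
  rewrite powRM//; last 2 first.
  - exact: ltW.
  - by rewrite addr_ge0// mulr_ge0// subr_ge0.
  rewrite ler_wpM2l ?powR_ge0// (le_trans (powR_convex2 _ l01 aA bB))//.
  by rewrite !powR_div.
apply: le_trans; first by apply: ler_sum => i _; exact: term.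
rewrite -mulr_sumr big_split /= -!mulr_sumr -!mulr_suml.
rewrite -[leRHS]mulr1 ler_wpM2l ?powR_ge0//.
rewrite [leRHS](_ : 1 = l * 1 + (1 - l) * 1); last by ring.
case/andP: l01 => l0 l1'.
by apply: lerD; rewrite ler_wpM2l ?subr_ge0// ler_pdivrMr ?mul1r ?powR_gt0.
Qed.

(** * Dyadic chaining *)

(** The strict steps of a nondecreasing integer sequence start at distinct
    points, and end at distinct points. *)
Lemma sum_step_source (R : realType) (phi : nat -> R) (a : nat -> nat) r :
  (forall j, 0 <= phi j) -> (forall i, (a i <= a i.+1)%N) ->
  \sum_(i < r) (a i < a i.+1)%N%:R * phi (a i) <= \sum_(j < a r) phi j.
Proof.
move=> phi0 ha; elim: r => [|r IH]; first by rewrite big_ord0 sumr_ge0.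
rewrite big_ord_recr /=; apply: (le_trans (lerD IH (lexx _))).
have [lt|_] := ltnP.
  rewrite mul1r; have -> : \sum_(j < a r) phi j + phi (a r) =
    \sum_(j < (a r).+1) phi j by rewrite big_ord_recr.
  rewrite -!(big_mkord xpredT phi).
  by rewrite [leRHS](big_cat_nat (n := (a r).+1)) //= lerDl sumr_ge0.
rewrite mul0r addr0 -!(big_mkord xpredT phi).
by rewrite [leRHS](big_cat_nat (n := a r)) //= lerDl sumr_ge0.
Qed.

Lemma sum_step_target (R : realType) (phi : nat -> R) (a : nat -> nat) r :
  (forall j, 0 <= phi j) -> (forall i, (a i <= a i.+1)%N) ->
  \sum_(i < r) (a i < a i.+1)%N%:R * phi (a i.+1) <= \sum_(j < (a r).+1) phi j.
Proof.
move=> phi0 ha; elim: r => [|r IH]; first by rewrite big_ord0 sumr_ge0.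
rewrite big_ord_recr /=; apply: (le_trans (lerD IH (lexx _))).
have [lt|_] := ltnP.
  rewrite mul1r [leRHS]big_ord_recr lerD2r -!(big_mkord xpredT phi).
  by rewrite [leRHS](big_cat_nat (n := (a r).+1)) //= lerDl sumr_ge0.
rewrite mul0r addr0 -!(big_mkord xpredT phi).
by rewrite [leRHS](big_cat_nat (n := (a r).+1)) //= ?lerDl ?sumr_ge0 ?ltnS.
Qed.

Lemma sum_mono_bound (R : realType) (phi : nat -> R) m n :
  (forall j, 0 <= phi j) -> (m <= n)%N ->
  \sum_(j < m) phi j <= \sum_(j < n) phi j.
Proof.
move=> phi0 mn; rewrite -!(big_mkord xpredT phi).
by rewrite [leRHS](big_cat_nat (n := m)) //= lerDl sumr_ge0.
Qed.

Lemma sum_even_odd (R : realType) (phi : nat -> R) m :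
  \sum_(j < m.*2) phi j = \sum_(b < m) (phi b.*2 + phi b.*2.+1).
Proof.
elim: m => [|m IH]; first by rewrite !big_ord0.
by rewrite doubleS !big_ord_recr /= IH addrA.
Qed.

(** Chaining by rounding: replacing every partition point [a i] by the even
    number below it changes each increment by at most two increments of the
    form [y (2 b + 1) - y (2 b)], and by [sum_step_source] and
    [sum_step_target] each of those is used at most twice. Minkowski's inequality
    then pays [2 A 0] for the rounding and leaves the sequence [y (2 b)]. At the
    last scale only one point is left and there is no increment. *)
Lemma dyadic_chaining (R : realType) (p : R) (K : nat) (y A : nat -> R) r
    (a : nat -> nat) : 1 <= p -> (forall k, 0 <= A k) ->
  (forall k, (k < K)%N ->
    \sum_(b < 2 ^ (K - k.+1)) `|y (b.*2.+1 * 2 ^ k)%N - y (b.*2 * 2 ^ k)%N| `^ p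
      <= A k `^ p) ->
  (forall i, (a i <= a i.+1)%N) -> (forall i, (a i < 2 ^ K)%N) ->
  \sum_(i < r) `|y (a i.+1) - y (a i)| `^ p <= (\sum_(k < K) A k *+ 2) `^ p.
Proof.
move=> p1; have p0 : p != 0 by rewrite gt_eqF// (lt_le_trans _ p1).
elim: K => [|K IH] in y A a *; move=> A0 hA ha aK.
  rewrite big1 ?powR_ge0// => i _.
  have a0 j : a j = 0%N by move: (aK j); rewrite expn0 ltnS leqn0 => /eqP.
  by rewrite !a0 subrr normr0 powR0.
pose e b := `|y b - y b./2.*2|.
pose s i : R := (a i < a i.+1)%N%:R.
have s_pow i x : 0 <= x -> (s i * x) `^ p = s i * x `^ p.
  by move=> x0; rewrite /s; case: ltnP => _; rewrite ?mul1r// !mul0r powR0.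
have se0 i j : 0 <= s i * e j by rewrite mulr_ge0 ?ler0n ?normr_ge0.
have e_sum : \sum_(j < 2 ^ K.+1) e j `^ p <= A 0%N `^ p.
  have := hA 0%N erefl; rewrite subn1 /= => /(le_trans _); apply.
  rewrite expnS mul2n (sum_even_odd (fun j => e j `^ p)).
  apply: ler_sum => b _; rewrite /e doubleK /= uphalf_double subrr normr0.
  by rewrite powR0// add0r expn0 !muln1.
have e0 j : 0 <= e j `^ p by exact: powR_ge0.
have y'_sum : \sum_(i < r) `|y (a i.+1)./2.*2 - y (a i)./2.*2| `^ p <=
    (\sum_(k < K) A k.+1 *+ 2) `^ p.
  apply: (IH (fun j => y j.*2) (fun k => A k.+1) (fun i => (a i)./2)) => //.
  - move=> k kK; rewrite (le_trans _ (hA k.+1 _))// subSS.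
    by apply: ler_sum => b _; rewrite expnSr !mulnA !muln2.
  - by move=> i; exact: half_leq.
  - by move=> i; have := aK i; rewrite expnS; lia.
have step i : `|y (a i.+1) - y (a i)| `^ p <=
    (s i * e (a i.+1) + s i * e (a i) +
     `|y (a i.+1)./2.*2 - y (a i)./2.*2|) `^ p.
  rewrite ge0_ler_powR ?nnegrE ?addr_ge0 ?(le_trans ler01 p1)//.
  rewrite /s; have [_|h] := ltnP (a i) (a i.+1).
    rewrite !mul1r /e.
    rewrite [X in `|X| <= _](_ : _ = (y (a i.+1) - y (a i.+1)./2.*2) -
      (y (a i) - y (a i)./2.*2) + (y (a i.+1)./2.*2 - y (a i)./2.*2)); last by ring.
    by rewrite (le_trans (ler_normD _ _))// lerD2r (le_trans (ler_normB _ _)).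
  have -> : a i.+1 = a i by apply/eqP; rewrite eqn_leq h ha.
  by rewrite !subrr normr0 !mul0r !addr0.
apply: le_trans; first by apply: ler_sum => i _; exact: step.
rewrite big_ord_recl /= mulr2n.
apply: (@minkowski_sum _ p r (fun i => s i * e (a i.+1) + s i * e (a i))
  (fun i => `|y (a i.+1)./2.*2 - y (a i)./2.*2|)) => //.
- by move=> i; rewrite addr_ge0.
- by rewrite addr_ge0.
- by rewrite sumr_ge0// => i _; rewrite mulrn_wge0.
apply: (@minkowski_sum _ p r (fun i => s i * e (a i.+1)) (fun i => s i * e (a i)))
  => //; try by move=> i; exact: se0.
- under eq_bigr do rewrite s_pow ?normr_ge0//.
  apply: le_trans (sum_step_target _ e0 ha) _; apply: le_trans e_sum.
  exact: (sum_mono_bound e0).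
- under eq_bigr do rewrite s_pow ?normr_ge0//.
  apply: le_trans (sum_step_source _ e0 ha) _; apply: le_trans e_sum.
  exact: (sum_mono_bound e0 (ltnW _)).
Qed.

(** * Variation along cells *)

Lemma clamp_bounds (R : realType) (l h x : R) : l <= h ->
  l <= Num.min (Num.max x l) h <= h.
Proof.
by move=> lh; rewrite le_min ge_min lh lexx orbT le_max lexx orbT.
Qed.

(** On one cell the increments of [w] add up to at most [hi j - lo j], each of
    them being at most that, so their p-th powers add up to at most
    [(hi j - lo j)^p]. Clamping [w] between [lo j] and [hi j] isolates the
    contribution of cell [j] and keeps the whole sum telescoping. *)
Lemma sum_within_cells (R : realType) (p : R) (J r : nat) (w lo hi : nat -> R)
    (a : nat -> nat) : 1 <= p ->
  (forall i, (a i < J)%N) -> (forall i, w i <= w i.+1) ->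
  (forall j, lo j <= hi j) -> (forall i, lo (a i) <= w i <= hi (a i)) ->
  \sum_(i < r) (a i == a i.+1)%:R * (w i.+1 - w i) `^ p
    <= \sum_(j < J) (hi j - lo j) `^ p.
Proof.
move=> p1 aJ hw lohi wcell; have p_gt0 : 0 < p by rewrite (lt_le_trans _ p1).
pose cl j x := Num.min (Num.max x (lo j)) (hi j).
have cl_mono j x z : x <= z -> cl j x <= cl j z.
  move=> xz; rewrite /cl le_min ge_min ge_min lexx orbT andbT; apply/orP; left.
  by rewrite ge_max le_max le_max xz lexx orbT.
have cl_id j x : lo j <= x <= hi j -> cl j x = x.
  by move=> /andP[lx xh]; rewrite /cl (max_idPl lx) (min_idPl xh).
have term i : (a i == a i.+1)%:R * (w i.+1 - w i) `^ p <=
    \sum_(j < J) (hi j - lo j) `^ (p - 1) * (cl j (w i.+1) - cl j (w i)).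
  have pos (j : 'I_J) :
      0 <= (hi j - lo j) `^ (p - 1) * (cl j (w i.+1) - cl j (w i)).
    by rewrite mulr_ge0 ?powR_ge0// subr_ge0 cl_mono.
  have [same|_] := eqVneq (a i) (a i.+1); last by rewrite mul0r sumr_ge0.
  rewrite mul1r (bigD1 (Ordinal (aJ i))) //= -[leLHS]addr0.
  apply: lerD; last by rewrite sumr_ge0.
  have := wcell i.+1; rewrite -same => wc'.
  rewrite !cl_id//; case/andP: (wcell i) => l1 h1; case/andP: wc' => l2 h2.
  have x0 : 0 <= w i.+1 - w i by rewrite subr_ge0.
  rewrite -mulr_powRB1// mulrC ler_wpM2r// ge0_ler_powR ?nnegrE ?subr_ge0//.
  by rewrite lerB.
apply: le_trans; first by apply: ler_sum => i _; exact: term.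
rewrite exchange_big /=; apply: ler_sum => j _.
rewrite -mulr_sumr -(big_mkord xpredT (fun i => cl j (w i.+1) - cl j (w i))).
rewrite telescope_sumr// -[leRHS]mulr_powRB1// ?subr_ge0// mulrC.
rewrite ler_wpM2r ?powR_ge0//.
by have /andP[_ ?] := clamp_bounds (w r) (lohi j);
   have /andP[? _] := clamp_bounds (w 0%N) (lohi j); rewrite lerB.
Qed.

(** The sequence [u] is [f] along a partition, [a] the cells that the partition
    visits, [w] a monotone function dominating the variation of [f], and [y]
    approximates [f] on each cell. A step inside a cell is paid by [w]; a step
    between cells is replaced by a step of [y], at the price of the oscillation
    of both cells, and each cell is left once and entered once. *)
Lemma variation_sum_le (R : realType) (p : R) (J K r : nat)
    (u w y lo hi A : nat -> R) (B : R) (a : nat -> nat) : 1 <= p ->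
  (J <= 2 ^ K)%N -> 0 <= B -> (forall k, 0 <= A k) ->
  (forall i, (a i <= a i.+1)%N) -> (forall i, (a i < J)%N) ->
  (forall i, w i <= w i.+1) ->
  (forall j, lo j <= hi j) -> (forall i, lo (a i) <= w i <= hi (a i)) ->
  (forall i, `|u i - y (a i)| <= hi (a i) - lo (a i)) ->
  (forall i, `|u i.+1 - u i| <= w i.+1 - w i) ->
  \sum_(j < J) (hi j - lo j) `^ p <= B `^ p ->
  (forall k, (k < K)%N ->
    \sum_(b < 2 ^ (K - k.+1)) `|y (b.*2.+1 * 2 ^ k)%N - y (b.*2 * 2 ^ k)%N| `^ p
      <= A k `^ p) ->
  \sum_(i < r) `|u i.+1 - u i| `^ p <= (B *+ 3 + \sum_(k < K) A k *+ 2) `^ p.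
Proof.
move=> p1 JK B0 A0 ha aJ hw lohi wcell uy uw hB hA.
have p0 : p != 0 by rewrite gt_eqF// (lt_le_trans _ p1).
pose D j := hi j - lo j; have D0 j : 0 <= D j by rewrite subr_ge0.
pose e i : R := (a i == a i.+1)%:R; pose s i : R := (a i < a i.+1)%N%:R.
have e_pow i x : 0 <= x -> (e i * x) `^ p = e i * x `^ p.
  by move=> x0; rewrite /e; case: eqVneq => _; rewrite ?mul1r// !mul0r powR0.
have s_pow i x : 0 <= x -> (s i * x) `^ p = s i * x `^ p.
  by move=> x0; rewrite /s; case: ltnP => _; rewrite ?mul1r// !mul0r powR0.
have Dp0 j : 0 <= D j `^ p by exact: powR_ge0.
have w0 i : 0 <= w i.+1 - w i by rewrite subr_ge0.
have ew0 i : 0 <= e i * (w i.+1 - w i) by rewrite mulr_ge0 ?ler0n.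
have sD0 i j : 0 <= s i * D j by rewrite mulr_ge0 ?ler0n.
have step i : `|u i.+1 - u i| `^ p <= (e i * (w i.+1 - w i) +
    s i * D (a i.+1) + s i * D (a i) + `|y (a i.+1) - y (a i)|) `^ p.
  rewrite ge0_ler_powR ?nnegrE ?addr_ge0 ?(le_trans ler01 p1)//.
  rewrite /e /s ltn_neqAle ha andbT; case: eqVneq => [E|_].
    by rewrite -E subrr normr0 !mul0r mul1r !addr0.
  rewrite mul0r add0r !mul1r.
  rewrite [X in `|X| <= _](_ : _ = (u i.+1 - y (a i.+1)) - (u i - y (a i)) +
    (y (a i.+1) - y (a i))); last by ring.
  rewrite (le_trans (ler_normD _ _))// lerD2r (le_trans (ler_normB _ _))//.
  by rewrite lerD// uy.
apply: le_trans; first by apply: ler_sum => i _; exact: step.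
have chain : \sum_(i < r) `|y (a i.+1) - y (a i)| `^ p <=
    (\sum_(k < K) A k *+ 2) `^ p.
  by apply: (@dyadic_chaining _ p K y A r a) => // i; exact: leq_trans (aJ i) JK.
have within : \sum_(i < r) (e i * (w i.+1 - w i)) `^ p <= B `^ p.
  under eq_bigr do rewrite e_pow//.
  exact: le_trans (sum_within_cells _ p1 aJ hw lohi wcell) hB.
have target : \sum_(i < r) (s i * D (a i.+1)) `^ p <= B `^ p.
  under eq_bigr do rewrite s_pow//.
  apply: le_trans (sum_step_target _ Dp0 ha) _; apply: le_trans hB.
  exact: (sum_mono_bound Dp0).
have source : \sum_(i < r) (s i * D (a i)) `^ p <= B `^ p.
  under eq_bigr do rewrite s_pow//.
  apply: le_trans (sum_step_source _ Dp0 ha) _; apply: le_trans hB.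
  exact: (sum_mono_bound Dp0 (ltnW _)).
have A_sum : 0 <= \sum_(k < K) A k *+ 2.
  by rewrite sumr_ge0// => k _; rewrite mulrn_wge0.
rewrite (_ : B *+ 3 = B + B + B); last by ring.
apply: (@minkowski_sum _ p r
  (fun i => e i * (w i.+1 - w i) + s i * D (a i.+1) + s i * D (a i))
  (fun i => `|y (a i.+1) - y (a i)|)) => //; rewrite ?addr_ge0//.
  by move=> i; rewrite !addr_ge0.
apply: (@minkowski_sum _ p r
  (fun i => e i * (w i.+1 - w i) + s i * D (a i.+1))
  (fun i => s i * D (a i))) => //; rewrite ?addr_ge0//.
  by move=> i; rewrite !addr_ge0.
exact: (@minkowski_sum _ p r (fun i => e i * (w i.+1 - w i))
  (fun i => s i * D (a i.+1))).
Qed.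

(** The sup norm costs a factor 2 only, because [f] vanishes at 0: the value
    [f t] is the increment over the partition [0 < t]. *)
Lemma pvar_norm_le (R : realType) (p : R) (J K : nat) (f g : R -> R)
    (c : R -> nat) (y lo hi A : nat -> R) (B : R) : 1 <= p ->
  (J <= 2 ^ K)%N -> 0 <= B -> (forall k, 0 <= A k) -> f 0 = 0 ->
  (forall s t, 0 <= s -> s <= t -> (c s <= c t)%N) ->
  (forall t, 0 <= t -> (c t < J)%N) ->
  (forall j, lo j <= hi j) -> (forall t, 0 <= t -> lo (c t) <= g t <= hi (c t)) ->
  (forall t, 0 <= t -> `|f t - y (c t)| <= hi (c t) - lo (c t)) ->
  (forall s t, 0 <= s -> s <= t -> `|f t - f s| <= g t - g s) ->
  \sum_(j < J) (hi j - lo j) `^ p <= B `^ p ->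
  (forall k, (k < K)%N ->
    \sum_(b < 2 ^ (K - k.+1)) `|y (b.*2.+1 * 2 ^ k)%N - y (b.*2 * 2 ^ k)%N| `^ p
      <= A k `^ p) ->
  (pvar_norm p f <= ((B *+ 3 + \sum_(k < K) A k *+ 2) *+ 2)%:E)%E.
Proof.
move=> p1 JK B0 A0 f0 hc cJ lohi gcell fy fg hB hA.
have p_gt0 : 0 < p by rewrite (lt_le_trans _ p1).
set M := _ + _; have M0 : 0 <= M.
  by rewrite addr_ge0 ?mulrn_wge0// sumr_ge0// => k _; rewrite mulrn_wge0.
have var m (t : nat -> R) : 0 <= t 0%N ->
    (forall j, (j < m)%N -> t j < t j.+1) ->
    \sum_(j < m) `|f (t j.+1) - f (t j)| `^ p <= M `^ p.
  move=> t0 tm.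
  (* Freezing the partition after its last point makes it monotone on all of
     nat without changing the sum. *)
  pose t' i := t (minn i m).
  have t'S i : t' i <= t' i.+1.
    rewrite /t'; have [im|mi] := ltnP i m.
      by rewrite (minn_idPl im) ltW// tm.
    by rewrite (minn_idPr (leqW mi)).
  have t'0 i : 0 <= t' i.
    by elim: i => [|i IH]; [rewrite /t' min0n|rewrite (le_trans IH)].
  have -> : \sum_(j < m) `|f (t j.+1) - f (t j)| `^ p =
      \sum_(j < m) `|f (t' j.+1) - f (t' j)| `^ p.
    apply: eq_bigr => j _; rewrite /t' (minn_idPl (ltn_ord j)).
    by rewrite (minn_idPl (ltnW (ltn_ord j))).
  apply: (@variation_sum_le _ p J K m (fun i => f (t' i)) (fun i => g (t' i))
    y lo hi A B (fun i => c (t' i))) => //.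
  - by move=> i; exact: hc.
  - by move=> i; exact: cJ.
  - by move=> i; rewrite -subr_ge0 (le_trans _ (fg _ _ (t'0 i) (t'S i))).
  - by move=> i; exact: gcell.
  - by move=> i; exact: fy.
  - by move=> i; exact: fg.
have root x : 0 <= x -> (x `^ p) `^ p^-1 = x.
  by move=> x0; rewrite -powRrM divff ?gt_eqF// powRr1.
have seminorm : (pvar_seminorm p f <= M%:E)%E.
  rewrite -[in leRHS](root M)// -poweR_EFin.
  have v0 : (0 <= pvariation p f)%E.
    apply: ereal_sup_ubound; exists 0%N, (fun=> 0); split => //.
    by rewrite big_ord0.
  apply: gt0_ler_poweR; rewrite ?invr_ge0 ?(ltW p_gt0)// ?in_itv/= ?leey ?andbT//.
    by rewrite lee_fin powR_ge0.
  apply: ge_ereal_sup => _ [m [t [t0 tm ->]]].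
  by rewrite lee_fin var.
have sup : (sup_norm f <= M%:E)%E.
  apply: ge_ereal_sup => _ [t /= t0 <-]; rewrite lee_fin.
  have [t_eq0|t_neq0] := eqVneq t 0; first by rewrite t_eq0 f0 normr0.
  have h : `|f t| `^ p <= M `^ p.
    have := var 1%N (fun i => if i is 0%N then 0 else t) (lexx 0).
    rewrite big_ord1 f0 subr0; apply => -[|//] _.
    by rewrite lt_def t_neq0.
  have pV0 : 0 <= p^-1 by rewrite invr_ge0 ltW.
  have := ge0_ler_powR pV0 (powR_ge0 `|f t| p) (powR_ge0 M p) h.
  by rewrite (root _ (normr_ge0 _)) (root _ M0).
by rewrite mulr2n EFinD; exact: leeD.
Qed.

(** * Linearising p-th powers *)

(** Stands in for the concavity of the p-th root: the p-th root of the right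
    hand side is affine in [V], and its mean is of order [alpha] as soon as the
    mean of [V] is of order [alpha^p]. *)
Lemma powR_le_linear (R : realType) (p alpha V : R) : 1 <= p -> 0 < alpha ->
  0 <= V -> V <= (alpha * (1 + V / alpha `^ p)) `^ p.
Proof.
move=> p1 a0 V0; have ap0 : 0 < alpha `^ p by rewrite powR_gt0.
have v0 : 0 <= V / alpha `^ p by rewrite divr_ge0 ?(ltW ap0).
rewrite powRM ?(ltW a0) ?addr_ge0// mulrC -ler_pdivrMr//.
apply: (@le_trans _ _ (1 + V / alpha `^ p)); first by rewrite lerDr.
by rewrite le1r_powR// lerDl.
Qed.

(** Reduces p-th moments to second moments; the bound is of the right order
    when [c] is the typical size of [x]. *)
Lemma powR_le_square (R : realType) (p c x : R) : 1 <= p -> p <= 2 -> 0 < c ->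
  0 <= x -> x `^ p <= c `^ (p - 2) * x ^+ 2 + c `^ p.
Proof.
move=> p1 p2 c0 x0; have p0 : 0 <= p by rewrite (le_trans ler01).
have [xc|cx] := leP x c.
  rewrite -[leLHS]add0r lerD ?mulr_ge0 ?powR_ge0 ?sqr_ge0//.
  by rewrite ge0_ler_powR ?nnegrE// ltW.
have x_gt0 : 0 < x by exact: lt_trans cx.
rewrite -[leLHS]addr0 lerD ?powR_ge0//.
have -> : x `^ p = x `^ (p - 2) * x ^+ 2.
  by rewrite -powR_mulrn ?(ltW x_gt0)// -powRD ?subrK// (gt_eqF x_gt0) implybT.
rewrite ler_wpM2r ?sqr_ge0// -[p - 2]opprB !powRN lef_pV2 ?posrE ?powR_gt0//.
by rewrite ge0_ler_powR ?nnegrE ?subr_ge0// ltW.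
Qed.

(** For counts with small mean, where it matters that there is no constant
    term. *)
Lemma powR_le_add_square (R : realType) (p z : R) : 1 <= p -> p <= 2 ->
  0 <= z -> z `^ p <= z + z ^+ 2.
Proof.
move=> p1 p2 z0; have [z1|z1] := leP z 1.
  have [->|z_neq0] := eqVneq z 0.
    by rewrite powR0 ?expr0n ?addr0// gt_eqF// (lt_le_trans ltr01).
  rewrite -[leLHS]addr0 lerD ?sqr_ge0// ge1r_powR//.
  by rewrite lt_def z_neq0 z0.
rewrite -[leLHS]add0r lerD// -powR_mulrn//.
by rewrite ler_powR// ltW.
Qed.

Lemma powR_exprn (R : realType) (x p : R) k : 0 <= x ->
  (x ^+ k) `^ p = (x `^ p) ^+ k.
Proof. by move=> x0; rewrite -(powR_mulrn k x0) powRAC powR_mulrn ?powR_ge0. Qed.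

Lemma sum_geometric_le (R : realType) (rho : R) K : 0 < rho -> rho < 1 ->
  \sum_(k < K) rho ^+ k <= (1 - rho)^-1.
Proof.
move=> r0 r1; rewrite -[leRHS]mul1r ler_pdivlMr ?subr_gt0//.
rewrite -[leLHS]opprK -mulrN opprB mulrC -subrX1 opprB gerBl.
by rewrite exprn_ge0// ltW.
Qed.

Lemma sum_gaps_le (R : realType) (L H : nat -> R) (q : R) m :
  (forall j, L j <= H j) -> (forall j, H j <= L j.+1) ->
  0 <= L 0%N -> (forall j, L j <= q) ->
  \sum_(j < m) (H j - L j) <= q.
Proof.
move=> LH HL L0 Lq.
apply: (@le_trans _ _ (\sum_(j < m) (L j.+1 - L j))).
  by apply: ler_sum => j _; rewrite lerB.
rewrite -(big_mkord xpredT (fun j => L j.+1 - L j)) telescope_sumr//.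
by rewrite lerBlDr (le_trans (Lq m))// lerDl.
Qed.

Lemma sum_powR_le_add_square (R : realType) (p n : R) (J : nat) (z : nat -> R) :
  1 <= p -> p <= 2 -> 0 < n -> (forall j, 0 <= z j) ->
  \sum_(j < J) (z j / n) `^ p <=
    (n `^ p)^-1 * \sum_(j < J) (z j + z j ^+ 2).
Proof.
move=> p1 p2 n0 z0; rewrite mulr_sumr; apply: ler_sum => j _.
rewrite powR_div ?(ltW n0)// mulrC ler_wpM2l ?invr_ge0 ?powR_ge0//.
exact: powR_le_add_square.
Qed.

Lemma sum_powR_le_square (R : realType) (p n c : R) (m : nat) (x : nat -> R) :
  1 <= p -> p <= 2 -> 0 < n -> 0 < c ->
  \sum_(j < m) `|x j / n| `^ p <=
    (n `^ p)^-1 * \sum_(j < m) (c `^ (p - 2) * x j ^+ 2 + c `^ p).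
Proof.
move=> p1 p2 n0 c0; rewrite mulr_sumr; apply: ler_sum => j _.
rewrite normrM normfV (gtr0_norm n0) powR_div ?(ltW n0)//.
rewrite mulrC ler_wpM2l ?invr_ge0 ?powR_ge0// -real_normK ?num_real//.
exact: powR_le_square.
Qed.

(** * Means of counts of independent events *)

(** Random variables are assembled from sums, positive multiples and squares;
    measurability and positivity are carried along with the bound because the
    integral is additive only with them. *)
Definition mean_at_most d (T : measurableType d) (R : realType)
    (P : probability T R) (f : T -> R) (b : R) : Prop :=
  [/\ measurable_fun setT f, (forall w, 0 <= f w) &
      (\int[P]_w (f w)%:E <= b%:E)%E].

Lemma mean_at_most_cst d (T : measurableType d) (R : realType)
    (P : probability T R) (c : R) : 0 <= c -> mean_at_most P (fun=> c) c.
Proof.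
move=> c0; split => //; rewrite integral_cst//.
by rewrite /= probability_setT mule1.
Qed.

Lemma mean_at_mostD d (T : measurableType d) (R : realType)
    (P : probability T R) (f g : T -> R) (b c : R) :
  mean_at_most P f b -> mean_at_most P g c ->
  mean_at_most P (fun w => f w + g w) (b + c).
Proof.
move=> [mf f0 fb] [mg g0 gc]; split.
- exact: measurable_funD.
- by move=> w; rewrite addr_ge0.
- under eq_integral do rewrite EFinD.
  rewrite ge0_integralD//; last 4 first.
  + by move=> x _; rewrite lee_fin.
  + exact/measurable_EFinP.
  + by move=> x _; rewrite lee_fin.
  + exact/measurable_EFinP.
  by rewrite EFinD leeD.
Qed.

Lemma mean_at_mostM d (T : measurableType d) (R : realType)
    (P : probability T R) (f : T -> R) (k b : R) : 0 <= k ->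
  mean_at_most P f b -> mean_at_most P (fun w => k * f w) (k * b).
Proof.
move=> k0 [mf f0 fb]; split.
- exact: measurable_funM.
- by move=> w; rewrite mulr_ge0.
- under eq_integral do rewrite EFinM.
  rewrite ge0_integralZl_EFin//; last 2 first.
  + by move=> x _; rewrite lee_fin.
  + exact/measurable_EFinP.
  by rewrite EFinM lee_wpmul2l// lee_fin.
Qed.

Lemma mean_at_most_le d (T : measurableType d) (R : realType)
    (P : probability T R) (f : T -> R) (b c : R) : b <= c ->
  mean_at_most P f b -> mean_at_most P f c.
Proof. by move=> bc [mf f0 fb]; split=> //; rewrite (le_trans fb) ?lee_fin. Qed.

Lemma mean_at_most_ext d (T : measurableType d) (R : realType)
    (P : probability T R) (f g : T -> R) (b : R) : f =1 g ->
  mean_at_most P f b -> mean_at_most P g b.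
Proof. by move=> /funext ->. Qed.

Lemma mean_at_most_sum d (T : measurableType d) (R : realType)
    (P : probability T R) (m : nat) (f : 'I_m -> T -> R) (b : 'I_m -> R) :
  (forall i, mean_at_most P (f i) (b i)) ->
  mean_at_most P (fun w => \sum_(i < m) f i w) (\sum_(i < m) b i).
Proof.
elim: m f b => [|m IH] f b h.
  rewrite big_ord0; apply: (@mean_at_most_ext _ _ _ _ (fun=> 0)).
    by move=> w; rewrite big_ord0.
  exact: mean_at_most_cst.
rewrite big_ord_recr /=.
apply: (@mean_at_most_ext _ _ _ _
  (fun w => \sum_(i < m) f (widen_ord (leqnSn m) i) w + f ord_max w)).
  by move=> w; rewrite big_ord_recr.
by apply: mean_at_mostD => //; apply: IH.
Qed.

Section counting_events.
Context d (T : measurableType d) (R : realType) (P : probability T R).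
Context (n : nat) (E : 'I_n -> set T) (mu : R).
Hypothesis mE : forall i, measurable (E i).
Hypothesis PE : forall i, P (E i) = mu%:E.
Hypothesis PEE : forall i l, i != l -> P (E i `&` E l) = (mu ^+ 2)%:E.

Let cnt w : R := \sum_(i < n) \1_(E i) w.

Let mcnt : measurable_fun setT cnt.
Proof. by apply: measurable_sum => i; exact: measurable_indic. Qed.

Let cnt0 w : 0 <= cnt w. Proof. by apply: sumr_ge0. Qed.

Let mean_indic (A : set T) : measurable A -> (\int[P]_w (\1_A w)%:E = P A)%E.
Proof. by move=> mA; rewrite integral_indic// setIT. Qed.

Let mean_cnt : (\int[P]_w (cnt w)%:E = (n%:R * mu)%:E)%E.
Proof.
under eq_integral do rewrite /cnt -sumEFin.
rewrite ge0_integral_sum//; last first.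
  by move=> i; apply/measurable_EFinP; exact: measurable_indic.
rewrite (eq_bigr (fun=> mu%:E)); last by move=> i _; rewrite mean_indic// PE.
by rewrite sumEFin sumr_const card_ord mulr_natl.
Qed.

Let mean_cnt2 : (\int[P]_w (cnt w ^+ 2)%:E =
  (n%:R * mu + n%:R * (n%:R - 1) * mu ^+ 2)%:E)%E.
Proof.
have cnt2 w : cnt w ^+ 2 = \sum_(i < n) \sum_(l < n) \1_(E i `&` E l) w.
  rewrite expr2 /cnt mulr_suml; apply: eq_bigr => i _.
  by rewrite mulr_sumr; apply: eq_bigr => l _; rewrite indicI.
have mEE i l : measurable (E i `&` E l) by exact: measurableI.
under eq_integral do rewrite cnt2 -sumEFin.
rewrite ge0_integral_sum//; last 2 first.
- move=> i; apply/measurable_EFinP; apply: measurable_sum => l.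
  exact: measurable_indic.
- by move=> i w _; rewrite lee_fin sumr_ge0.
have inner i : (\int[P]_w (\sum_(l < n) \1_(E i `&` E l) w)%:E =
    (mu + (n%:R - 1) * mu ^+ 2)%:E)%E.
  under eq_integral do rewrite -sumEFin.
  rewrite ge0_integral_sum//; last first.
    by move=> l; apply/measurable_EFinP; exact: measurable_indic.
  under eq_bigr do rewrite mean_indic//.
  rewrite (bigD1 i)//= setIid PE EFinD; congr (_ + _)%E.
  under eq_bigr => l il do rewrite PEE 1?eq_sym//.
  rewrite sumEFin sumr_const -[X in X%:E = _]mulr_natl cardC1 card_ord.
  by rewrite -subn1 natrB// (leq_ltn_trans _ (ltn_ord i)).
under eq_bigr do rewrite inner.
by rewrite sumEFin sumr_const card_ord -[X in X%:E = _]mulr_natl; congr _%:E; ring.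
Qed.

Let nmu0 : 0 <= n%:R * mu.
Proof. by rewrite -lee_fin -mean_cnt integral_ge0// => w _; rewrite lee_fin. Qed.

Lemma mean_count : mean_at_most P cnt (n%:R * mu).
Proof. by split=> //; rewrite mean_cnt. Qed.

Lemma mean_count_sq : mean_at_most P (fun w => cnt w ^+ 2)
  (n%:R * mu + (n%:R * mu) ^+ 2).
Proof.
split; first exact: measurable_funX.
- by move=> w; exact: sqr_ge0.
rewrite mean_cnt2 lee_fin lerD2l exprMn ler_wpM2r ?sqr_ge0//.
by rewrite expr2 ler_wpM2l// gerBl.
Qed.

(** Pairwise independence makes the variance of the count at most its mean. *)
Lemma mean_count_centered_sq :
  mean_at_most P (fun w => (cnt w - n%:R * mu) ^+ 2) (n%:R * mu).
Proof.
have msub : measurable_fun setT (fun w => (cnt w - n%:R * mu) ^+ 2).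
  by apply: measurable_funX; exact: measurable_funB.
split=> //; first by move=> w; exact: sqr_ge0.
have split_sq : (\int[P]_w ((cnt w - n%:R * mu) ^+ 2 +
    (n%:R * mu *+ 2) * cnt w)%:E = \int[P]_w (cnt w ^+ 2 + (n%:R * mu) ^+ 2)%:E)%E.
  by apply: eq_integral => w _; congr _%:E; ring.
move: split_sq; under eq_integral do rewrite EFinD.
rewrite ge0_integralD//; last 4 first.
- by move=> w _; rewrite lee_fin sqr_ge0.
- exact/measurable_EFinP.
- by move=> w _; rewrite lee_fin mulr_ge0// mulrn_wge0.
- by apply/measurable_EFinP; exact: measurable_funM.
under [X in (_ + X)%E]eq_integral do rewrite EFinM.
rewrite ge0_integralZl_EFin//; last 3 first.
- by move=> w _; rewrite lee_fin.
- exact/measurable_EFinP.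
- by rewrite mulrn_wge0.
under [X in _ = X]eq_integral do rewrite EFinD.
rewrite ge0_integralD//; last 3 first.
- by move=> w _; rewrite lee_fin sqr_ge0.
- by apply/measurable_EFinP; exact: measurable_funX.
- by move=> w _; rewrite lee_fin sqr_ge0.
rewrite mean_cnt mean_cnt2 integral_cst//= probability_setT mule1.
rewrite -EFinM -EFinD; case: (\int[P]_w _)%E => [I [hI]| |] //.
rewrite lee_fin -subr_ge0 (_ : _ - I = n%:R * mu ^+ 2).
  by rewrite mulr_ge0// sqr_ge0.
move: hI => /(canRL (addrK _)) ->; ring.
Qed.

End counting_events.

Section integral_bound.
Import HBNNSimple.

(** No measurability of [f] is assumed: the p-variation norm is a supremum over
    uncountably many partitions. The integral of [f] is then the supremum over
    the simple functions below [f], so that a measurable bound that holds almost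
    surely is still enough. *)
Lemma le_integral_ae d (T : measurableType d) (R : realType)
    (P : probability T R) (f : T -> \bar R) (g : T -> R) (Z : set T) :
  (forall w, 0 <= f w)%E -> (forall w, 0 <= g w) -> measurable_fun setT g ->
  measurable Z -> P Z = 0%E -> (forall w, ~ Z w -> (f w <= (g w)%:E)%E) ->
  (\int[P]_w f w <= \int[P]_w (g w)%:E)%E.
Proof.
move=> f0 g0 mg mZ PZ fg.
rewrite (ge0_integralTE _ f0); apply: ge_ereal_sup => _ [h /= hf <-].
have mh : measurable_fun setT (EFin \o h) by exact/measurable_EFinP.
have -> : sintegral P h = (\int[P]_w (h w)%:E)%E.
  by rewrite integral_nnsfun// patch_setT.
apply: ae_ge0_le_integral => //.
- by move=> w _; rewrite lee_fin.
- by move=> w _; rewrite lee_fin.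
- exact/measurable_EFinP.
exists Z; split => // w /= hgw; apply: contrapT => nZ; apply: hgw => _.
exact: le_trans (hf w) (fg w nZ).
Qed.

End integral_bound.

(** * Events on paths and the law of a process *)

(** Without a maximum, every point of [A] is below some rational that is below
    another point of [A], so it suffices to pick a point of [A] above each
    rational that has one; running maxima make the sequence monotone. *)
Lemma cofinal_seq (R : realType) (A : set R) : A !=set0 ->
  exists u : nat -> R, [/\ forall k, A (u k), forall k, u k <= u k.+1 &
    forall t, A t -> exists k, t <= u k].
Proof.
move=> [x0 Ax0].
have [[m [Am m_max]]|no_max] := pselect (exists m, A m /\ forall t, A t -> t <= m).
  by exists (fun=> m); split => // t /m_max; exists 0%N.
pose q k : R := if unpickle k is Some r then ratr r else 0.
have /choice[v hv] k : exists v, A v /\ forall x, A x -> q k <= x -> q k <= v.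
  have [[x [Ax qx]]|no_x] := pselect (exists x, A x /\ q k <= x).
    by exists x; split.
  by exists x0; split=> // x Ax qx; exfalso; apply: no_x; exists x.
pose u := fix u k := if k is k'.+1 then Num.max (u k') (v k) else v 0%N.
have vu k : v k <= u k by case: k => //= k; rewrite le_max lexx orbT.
exists u; split.
- elim=> [|k IH] /=; first exact: (hv 0%N).1.
  by rewrite /Num.max; case: ifP => _ //; exact: (hv k.+1).1.
- by move=> k /=; rewrite le_max lexx.
move=> t At; have [t' [At' tt']] : exists t', A t' /\ t < t'.
  apply: contrapT => no_t'; apply: no_max; exists t; split=> // x Ax.
  by rewrite leNgt; apply/negP => tx; apply: no_t'; exists x.
have [r] := rat_in_itvoo tt'; rewrite in_itv /= => /andP[tr rt'].
exists (pickle r); rewrite (le_trans _ (vu _))//.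
have qr : q (pickle r) = ratr r by rewrite /q pickleK.
rewrite (le_trans (ltW tr))// -qr; apply: (hv _).2 At' _.
by rewrite qr ltW.
Qed.

Lemma coinitial_seq (R : realType) (A : set R) : A !=set0 ->
  exists u : nat -> R, [/\ forall k, A (u k), forall k, u k.+1 <= u k &
    forall t, A t -> exists k, u k <= t].
Proof.
move=> [x Ax]; have [|u [Au u_le u_cof]] := @cofinal_seq R [set t | A (- t)].
  by exists (- x); rewrite /= opprK.
exists (fun k => - u k); split => [//|k|t At]; first by rewrite lerN2.
have [|k tk] := u_cof (- t); first by rewrite /= opprK.
by exists k; rewrite lerNl.
Qed.

(** For a simple counting path the indicator of this event is the value at [t],
    so that moments of the process become probabilities. *)
Definition jumped (R : realType) (t : \bar R) : set (\bar R -> R) :=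
  [set x | 1 <= x t].

Section path_events.
Context (R : realType).
Implicit Types (x : \bar R -> R) (A B : set (\bar R -> R)).

Lemma jumped_le x s t : is_counting_path x -> (0 <= s)%E -> (s <= t)%E ->
  jumped s x -> jumped t x.
Proof.
by move=> cx s0 st /le_trans; apply; exact: counting_incr cx _ _ s0 st.
Qed.

Lemma cylinder_jumped (t : \bar R) : (0 <= t)%E -> <<s @cylinders R >> (jumped t).
Proof.
move=> t0; apply: sub_sigma_algebra; exists t, [set` `[1, +oo[%R]; split => //.
by apply/seteqP; split => x; rewrite /jumped /= in_itv /= andbT.
Qed.

Lemma cylinder_bigcap (A : nat -> set (\bar R -> R)) :
  (forall k, <<s @cylinders R >> (A k)) -> <<s @cylinders R >> (\bigcap_k A k).
Proof.
move=> mA.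
apply: (@bigcap_measurable _ (g_sigma_algebraType (@cylinders R)) A setT).
- by exists 0%N.
- by move=> k _; exact: mA.
Qed.

Lemma cylinder_bigcup (A : nat -> set (\bar R -> R)) :
  (forall k, <<s @cylinders R >> (A k)) -> <<s @cylinders R >> (\bigcup_k A k).
Proof.
move=> mA.
apply: (@bigcup_measurable _ (g_sigma_algebraType (@cylinders R)) A setT).
by move=> k _; exact: mA.
Qed.

Lemma cylinderU A B : <<s @cylinders R >> A -> <<s @cylinders R >> B ->
  <<s @cylinders R >> (A `|` B).
Proof. exact: (@measurableU _ (g_sigma_algebraType (@cylinders R))). Qed.

Lemma cylinderD A B : <<s @cylinders R >> A -> <<s @cylinders R >> B ->
  <<s @cylinders R >> (A `\` B).
Proof. exact: (@measurableD _ (g_sigma_algebraType (@cylinders R))). Qed.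

Lemma measurable_path d (T : measurableType d) (P : probability T R)
    (N : process P) A : <<s @cylinders R >> A -> measurable (Defs.path N @^-1` A).
Proof.
have mN : measurable_fun setT
    (Defs.path N : T -> g_sigma_algebraType (@cylinders R)).
  apply: (@measurability _ _ _ (g_sigma_algebraType (@cylinders R)) _ _
    (@cylinders R)) => // _ [_ [s [B [_ mB ->]]] <-].
  by rewrite setTI; exact: measurable_funPTI.
by move=> mA; rewrite -[X in measurable X]setTI; exact: mN.
Qed.

End path_events.

Section law.
Context (R : realType) d (T : measurableType d) (P : probability T R).
Context (N : process P).
Implicit Types A B : set (\bar R -> R).

Definition law A : R := fine (P (Defs.path N @^-1` A)).

Lemma lawE A : <<s @cylinders R >> A -> P (Defs.path N @^-1` A) = (law A)%:E.
Proof. by move=> mA; rewrite fineK// fin_num_measure//; exact: measurable_path. Qed.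

Lemma law_ge0 A : 0 <= law A. Proof. exact: fine_ge0. Qed.

Lemma law_le A B : <<s @cylinders R >> A -> <<s @cylinders R >> B ->
  (forall w, A (Defs.path N w) -> B (Defs.path N w)) -> law A <= law B.
Proof.
move=> mA mB AB; rewrite -lee_fin -!lawE// le_measure ?inE//.
- exact: measurable_path.
- exact: measurable_path.
Qed.

Lemma lawD A B : <<s @cylinders R >> A -> <<s @cylinders R >> B ->
  (forall w, A (Defs.path N w) -> B (Defs.path N w)) ->
  law (B `\` A) = law B - law A.
Proof.
move=> mA mB AB; apply: EFin_inj; rewrite EFinB -!lawE//; last exact: cylinderD.
rewrite -[_ @^-1` _]/((Defs.path N @^-1` B) `\` (Defs.path N @^-1` A)).
rewrite measureD.
- by rewrite setIidr.
- exact: measurable_path.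
- exact: measurable_path.
- by rewrite /= lawE// ltry.
Qed.

Lemma law_bigcup_le (A : nat -> set (\bar R -> R)) (b : R) :
  (forall k, <<s @cylinders R >> (A k)) ->
  (forall k w, A k (Defs.path N w) -> A k.+1 (Defs.path N w)) ->
  (forall k, law (A k) <= b) -> law (\bigcup_k A k) <= b.
Proof.
move=> mA A_nd Ab; rewrite -lee_fin -lawE; last exact: cylinder_bigcup.
rewrite preimage_bigcup.
have mF k : measurable (Defs.path N @^-1` A k) by exact: measurable_path.
have nd : {homo (fun k => Defs.path N @^-1` A k) : n m / (n <= m)%N >-> (n <= m)%O}.
  by apply/nondecreasing_seqP => k; apply/subsetPset => w; exact: A_nd.
have cv := @nondecreasing_cvg_mu _ _ _ P _ mF (bigcupT_measurable _ mF) nd.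
apply: (cvge_to_le cv).
by apply: nearW => k /=; rewrite lawE// lee_fin.
Qed.

Lemma law_bigcap_ge (A : nat -> set (\bar R -> R)) (b : R) :
  (forall k, <<s @cylinders R >> (A k)) ->
  (forall k w, A k.+1 (Defs.path N w) -> A k (Defs.path N w)) ->
  (forall k, b <= law (A k)) -> b <= law (\bigcap_k A k).
Proof.
move=> mA A_ni Ab; rewrite -lee_fin -lawE; last exact: cylinder_bigcap.
rewrite -[_ @^-1` _]/(\bigcap_k (Defs.path N @^-1` A k)).
have mF k : measurable (Defs.path N @^-1` A k) by exact: measurable_path.
have ni : {homo (fun k => Defs.path N @^-1` A k) : n m / (n <= m)%N >-> (m <= n)%O}.
  by apply/nonincreasing_seqP => k; apply/subsetPset => w; exact: A_ni.
have fin0 : (P (Defs.path N @^-1` A 0%N) < +oo)%E by rewrite lawE// ltry.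
have cv := @nonincreasing_cvg_mu _ _ _ P _ fin0 mF (bigcapT_measurable mF) ni.
apply: (cvge_to_ge cv).
by apply: nearW => k /=; rewrite lawE// lee_fin.
Qed.

End law.

(** * Cutting time at the quantiles of the mean function *)

Section quantile_cuts.
Context (R : realType) d (T : measurableType d) (P : probability T R).
Context (N : process P) (n : nat).
Hypothesis cN : counting_process N.
Hypothesis n_gt0 : (0 < n)%N.

Let F (t : \bar R) : R := law N (jumped t).

Let F_le (s t : \bar R) : (0 <= s)%E -> (s <= t)%E -> F s <= F t.
Proof.
move=> s0 st; apply: law_le => [||w].
- exact: cylinder_jumped.
- by apply: cylinder_jumped; exact: le_trans st.
- exact: jumped_le (cN w) s0 st.
Qed.

Let nF_le (s t : \bar R) : (0 <= s)%E -> (s <= t)%E -> n%:R * F s <= n%:R * F t.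
Proof. by move=> s0 st; rewrite ler_wpM2l// F_le. Qed.

Lemma law_jumped0 : law N (jumped 0%E) = 0.
Proof.
rewrite /law (_ : _ @^-1` _ = set0) ?measure0//.
apply/seteqP; split=> w //=; rewrite /jumped /= (counting_0 (cN w)).
by rewrite leNgt ltr01.
Qed.

Definition cell (t : R) : nat := Num.truncn (n%:R * F t%:E).

Let nF0 t : 0 <= n%:R * F t.
Proof. by rewrite mulr_ge0// law_ge0. Qed.

Lemma cell_le s t : 0 <= s -> s <= t -> (cell s <= cell t)%N.
Proof. by move=> s0 st; apply: le_truncn; apply: nF_le; rewrite lee_fin. Qed.

Let cell_itv t : (cell t)%:R <= n%:R * F t%:E < (cell t).+1%:R.
Proof. exact: truncn_itv. Qed.

Lemma cell_lt t : 0 <= t -> (cell t < (Num.truncn (n%:R * F +oo%E)).+1)%N.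
Proof. by move=> t0; apply: le_truncn; apply: nF_le; rewrite ?lee_fin// leey. Qed.

(* If n * F never reaches j in finite time, s is constantly +oo, so that the
   corresponding event is that the path jumps at all rather than the sure
   event: the masses of the cells must not add up to more than F(oo). *)
Let left_end j : exists s : nat -> \bar R,
  [/\ forall k, (0 <= s k)%E,
      forall k, (s k.+1 <= s k)%E,
      forall k, (j%:R <= n%:R * F (s k)) \/ s k = +oo%E,
      forall t, 0 <= t -> j%:R <= n%:R * F t%:E -> exists k, (s k <= t%:E)%E &
      forall k t, 0 <= t -> n%:R * F t%:E < j%:R -> (t%:E <= s k)%E].
Proof.
pose U := [set t : R | 0 <= t /\ j%:R <= n%:R * F t%:E].
have [U0|no_U] := pselect (U !=set0); last first.
  exists (fun=> +oo%E); split => // [k|t t0 jt|k t _ _]; rewrite ?leey//.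
  - by right.
  - by exfalso; apply: no_U; exists t.
have [u [Uu u_le u_ci]] := coinitial_seq U0.
exists (fun k => (u k)%:E); split => [k|k|k|t t0 jt|k t t0 tj].
- by rewrite lee_fin; exact: (Uu k).1.
- by rewrite lee_fin.
- by left; exact: (Uu k).2.
- by have [k uk] := u_ci t (conj t0 jt); exists k; rewrite lee_fin.
- rewrite lee_fin leNgt; apply/negP => ut; have [u0 ju] := Uu k.
  have := lt_le_trans tj ju; rewrite ltNge nF_le// ?lee_fin//.
  exact: ltW.
Qed.

Let right_end j : exists t : nat -> R,
  [/\ forall k, 0 <= t k,
      forall k, t k <= t k.+1,
      forall k, n%:R * F (t k)%:E < j.+1%:R &
      forall s, 0 <= s -> n%:R * F s%:E < j.+1%:R -> exists k, s <= t k].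
Proof.
have L0 : [set t : R | 0 <= t /\ n%:R * F t%:E < j.+1%:R] !=set0.
  by exists 0; split => //; rewrite /F law_jumped0 mulr0.
have [t [Lt t_le t_co]] := cofinal_seq L0.
exists t; split => // [k|k|s s0 sj].
- exact: (Lt k).1.
- exact: (Lt k).2.
- by apply: t_co; split.
Qed.

(** The range of [n * F] is cut at the integers. The path satisfies [lo j] when
    it has jumped by every time at which [n * F] has reached [j]; [hi j] also
    admits the paths that have jumped by some time at which [n * F] is still
    below [j + 1]. So a path in [hi j] but not in [lo j] jumps inside cell [j].
    Both events are countable limits of cylinders, because a cell may lack a
    first or a last time. The last bound holds even if [F] has atoms of mass
    larger than [1 / n]: a path that jumps at such an atom is already counted
    in [lo] for the cell that starts there. *)
Lemma quantile_cuts : exists lo hi : nat -> set (\bar R -> R),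
  [/\ forall j, <<s @cylinders R >> (lo j) /\ <<s @cylinders R >> (hi j),
      forall x j, is_counting_path x ->
        (lo j x -> hi j x) /\ (hi j x -> lo j.+1 x),
      forall x j, is_counting_path x -> lo j x -> jumped +oo%E x,
      forall x t, is_counting_path x -> 0 <= t ->
        (lo (cell t) x -> jumped t%:E x) /\ (jumped t%:E x -> hi (cell t) x) &
      forall j, j%:R <= n%:R * F +oo%E ->
        n%:R * (law N (hi j) - law N (lo j)) <= 1].
Proof.
have /choice[s hs] := left_end; have /choice[t ht] := right_end.
pose lo j := \bigcap_k jumped (s j k).
pose hi j := lo j `|` \bigcup_k jumped (t j k)%:E.
have t0 j k : (0 <= (t j k)%:E)%E by rewrite lee_fin; have [] := ht j.
have s0 j k : (0 <= s j k)%E by have [] := hs j.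
have mlo j : <<s @cylinders R >> (lo j).
  by apply: cylinder_bigcap => k; exact: cylinder_jumped.
have mjt j k : <<s @cylinders R >> (jumped (t j k)%:E).
  exact: cylinder_jumped.
have mhi j : <<s @cylinders R >> (hi j).
  by apply: cylinderU => //; exact: cylinder_bigcup.
have lo_oo x j : is_counting_path x -> lo j x -> jumped +oo%E x.
  by move=> cx /(_ 0%N I); apply: jumped_le => //; rewrite leey.
have before_lo x j u : is_counting_path x -> 0 <= u -> n%:R * F u%:E < j%:R ->
    jumped u%:E x -> lo j x.
  move=> cx u0 uj ju k _; apply: jumped_le ju => //; rewrite ?lee_fin//.
  by have [_ _ _ _] := hs j; exact.
have lo_after x j u : is_counting_path x -> 0 <= u -> j%:R <= n%:R * F u%:E ->
    lo j x -> jumped u%:E x.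
  move=> cx u0 ju lx; have [_ _ _ /(_ u u0 ju)[k sk] _] := hs j.
  by apply: jumped_le (lx k I).
have lo_lo x j : is_counting_path x -> lo j x -> lo j.+1 x.
  move=> cx lx k _; have [_ _ /(_ k) + _ _] := hs j.+1.
  case=> [|->]; last exact: lo_oo cx lx.
  move: (s0 j.+1 k); case: (s j.+1 k) => [u| |] // u0 ju.
    apply: (lo_after x j u) => //; apply: le_trans ju.
    by rewrite ler_nat.
  exact: lo_oo cx lx.
have hi_lo x j : is_counting_path x -> hi j x -> lo j.+1 x.
  move=> cx [/lo_lo|[k _ jx]]; first exact.
  by apply: before_lo jx => //; have [? _ ? _] := ht j.
exists lo, hi; split => // [x j cx|x u cx u0|j jn].
- by split; [left|exact: hi_lo].
- have /andP[cu uc] := cell_itv u; split; first exact: lo_after.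
  move=> ju; right; have [_ _ _ /(_ u u0 uc)[k uk]] := ht (cell u).
  by exists k => //; apply: jumped_le ju; rewrite ?lee_fin.
have n_pos : 0 < n%:R :> R by rewrite ltr0n.
have nlo : j%:R <= n%:R * law N (lo j).
  rewrite mulrC -ler_pdivrMr//; apply: law_bigcap_ge => [k|k w|k].
  - exact: cylinder_jumped.
  - by apply: jumped_le => //; have [] := hs j.
  - rewrite ler_pdivrMr// mulrC; have [_ _ /(_ k) + _ _] := hs j.
    by case=> [|->].
rewrite -lawD//; last by move=> w; left.
rewrite mulrC -ler_pdivlMr//.
apply: (@le_trans _ _ (law N (\bigcup_k (jumped (t j k)%:E `\` lo j)))).
  apply: law_le => [||w [[//|[k _ jx]] nl]].
  - exact: cylinderD.
  - by apply: cylinder_bigcup => k; exact: cylinderD.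
  - by exists k.
apply: law_bigcup_le => [k|k w [jx nl]|k].
- exact: cylinderD.
- split=> //; apply: jumped_le jx => //; rewrite lee_fin.
  by have [_ + _ _] := ht j; exact.
have [tk0 _ tkj _] := ht j.
have [jt|tj] := leP j%:R (n%:R * F (t j k)%:E); last first.
  rewrite (_ : law N _ = 0) ?divr_ge0//; rewrite /law (_ : _ @^-1` _ = set0).
    by rewrite measure0.
  apply/seteqP; split => w //= -[jx]; apply.
  exact: before_lo jx.
rewrite lawD//; last first.
  by move=> w; apply: lo_after.
rewrite ler_pdivlMr// mulrC mulrBr lerBlDr (le_trans (ltW (tkj k)))//.
by rewrite -addn1 natrD addrC lerD2l.
Qed.

End quantile_cuts.

(** * Independent copies of a simple counting process *)

Lemma simple_path_value (R : realType) (x : \bar R -> R) (t : \bar R) :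
  is_counting_path x -> x +oo%E <= 1 -> (0 <= t)%E -> x t = \1_(jumped t) x.
Proof.
move=> cx x1 t0; have [k xk] := counting_nat cx t0.
have := counting_incr cx t0 (leey t); rewrite xk => /le_trans/(_ x1).
rewrite lern1 indicE => k1; case: (boolP (_ \in _)).
  by rewrite inE /jumped /= xk ler1n; case: k k1 {xk} => [|[]].
by rewrite notin_setE /jumped /= xk ler1n; case: k k1 {xk} => [|[]].
Qed.

Lemma mean_fun_law (R : realType) d (T : measurableType d)
    (P : probability T R) (N : process P) (t : \bar R) :
  counting_process N -> simple_process N -> (0 <= t)%E ->
  mean_fun N t = law N (jumped t).
Proof.
move=> cN sN t0; rewrite /mean_fun /law.
have -> : (N t : T -> R) = \1_(Defs.path N @^-1` (jumped t)).
  apply/funext => w.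
  rewrite -[LHS]/(Defs.path N w t) (simple_path_value (cN w) _ t0)//.
  exact: sN (leey _) .
rewrite expectation_indic//; apply: measurable_path; exact: cylinder_jumped.
Qed.

Section empirical_process.
Context (R : realType) d0 (T0 : measurableType d0) (P0 : probability T0 R).
Context (N : process P0) d (T : measurableType d) (P : probability T R).
Context (n : nat) (Ns : 'I_n -> process P).
Hypothesis cN : counting_process N.
Hypothesis sN : simple_process N.
Hypothesis n_gt0 : (0 < n)%N.
Hypothesis cNs : forall i, counting_process (Ns i).
Hypothesis lawNs : forall i, same_law (Ns i) N.
Hypothesis indNs : independent_processes Ns.

Definition num_paths (A : set (\bar R -> R)) (w : T) : R :=
  \sum_(i < n) \1_(Defs.path (Ns i) @^-1` A) w.

Lemma num_paths_ge0 A w : 0 <= num_paths A w.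
Proof. by rewrite sumr_ge0. Qed.

Let PE A i : <<s @cylinders R >> A ->
  P (Defs.path (Ns i) @^-1` A) = (law N A)%:E.
Proof. by move=> mA; rewrite lawNs// lawE. Qed.

Let PEE A i l : <<s @cylinders R >> A -> i != l ->
  P (Defs.path (Ns i) @^-1` A `&` Defs.path (Ns l) @^-1` A) = (law N A ^+ 2)%:E.
Proof.
move=> mA il; pose B k := if (k == i) || (k == l) then A else setT.
have mB k : <<s @cylinders R >> (B k).
  rewrite /B; case: ifP => // _.
  exact: (@measurableT _ (g_sigma_algebraType (@cylinders R))).
have := indNs mB.
rewrite (bigD1 i)//= (bigD1 l) 1?eq_sym//= big1 ?mule1; last first.
  by move=> k /andP[ki kl]; rewrite /B (negbTE ki) (negbTE kl) probability_setT.
rewrite {2}/B eqxx /= {2}/B eqxx orbT !PE// expr2 EFinM => <-; congr (P _).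
apply/seteqP; split => [w [Ai Al] k _|w h].
  by rewrite /B /=; case: ifP => // /orP[]/eqP ->.
by split; [move: (h i I)|move: (h l I)]; rewrite /B /= eqxx ?orbT.
Qed.

Lemma mean_count_law A : <<s @cylinders R >> A ->
  mean_at_most P (num_paths A) (n%:R * law N A).
Proof.
move=> mA; apply: (@mean_count _ _ _ _ _ (fun i => Defs.path (Ns i) @^-1` A)).
- by move=> i; exact: measurable_path.
- by move=> i; exact: PE.
Qed.

Lemma mean_count_sq_law A : <<s @cylinders R >> A ->
  mean_at_most P (fun w => num_paths A w ^+ 2)
    (n%:R * law N A + (n%:R * law N A) ^+ 2).
Proof.
move=> mA; apply: (@mean_count_sq _ _ _ _ _ (fun i => Defs.path (Ns i) @^-1` A)).
- by move=> i; exact: measurable_path.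
- by move=> i; exact: PE.
- by move=> i l; exact: PEE.
Qed.

Lemma mean_count_centered_sq_law A : <<s @cylinders R >> A ->
  mean_at_most P (fun w => (num_paths A w - n%:R * law N A) ^+ 2) (n%:R * law N A).
Proof.
move=> mA.
apply: (@mean_count_centered_sq _ _ _ _ _ (fun i => Defs.path (Ns i) @^-1` A)).
- by move=> i; exact: measurable_path.
- by move=> i; exact: PE.
- by move=> i l; exact: PEE.
Qed.

Lemma num_paths_le A B w :
  (forall i, A (Defs.path (Ns i) w) -> B (Defs.path (Ns i) w)) ->
  num_paths A w <= num_paths B w.
Proof.
move=> AB; apply: ler_sum => i _; rewrite !indicE ler_nat.
case: (boolP (w \in _ @^-1` A)) => //; rewrite inE => /AB wB.
by rewrite mem_set.
Qed.

Lemma num_pathsD A B w :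
  (forall i, A (Defs.path (Ns i) w) -> B (Defs.path (Ns i) w)) ->
  num_paths (B `\` A) w = num_paths B w - num_paths A w.
Proof.
move=> AB; rewrite /num_paths -sumrB; apply: eq_bigr => i _.
rewrite -[_ @^-1` (_ `\` _)]/((Defs.path (Ns i) @^-1` B) `\`
  (Defs.path (Ns i) @^-1` A)).
rewrite !indicE in_setD; case: (boolP (w \in _ @^-1` A)) => /=.
  by rewrite inE => /AB wB; rewrite mem_set// subrr.
by rewrite andbT subr0.
Qed.

(** The copies only share the law of [N], so they are simple almost surely
    but not surely. *)
Definition not_simple : set T :=
  \bigcup_(i in [set: 'I_n]) (Defs.path (Ns i) @^-1` [set x | 1 < x +oo%E]).

Let cylinder_not_simple : <<s @cylinders R >> [set x : \bar R -> R | 1 < x +oo%E].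
Proof.
apply: sub_sigma_algebra; exists +oo%E, [set` `]1, +oo[%R]; split => //.
by apply/seteqP; split => x; rewrite /= in_itv /= andbT.
Qed.

Lemma measurable_not_simple : measurable not_simple.
Proof.
by apply: fin_bigcup_measurable => // i _; exact: measurable_path.
Qed.

Lemma not_simple_null : P not_simple = 0%E.
Proof.
pose A : set (\bar R -> R) := [set x | 1 < x +oo%E].
have law0 : law N A = 0.
  rewrite /law (_ : _ @^-1` _ = set0) ?measure0//.
  by apply/seteqP; split => w //=; rewrite /A /= ltNge sN// leey.
have [mc c0 Ec] := mean_count_law cylinder_not_simple.
apply/eqP; rewrite eq_le measure_ge0 andbT.
rewrite law0 mulr0 in Ec; apply: le_trans Ec.
have mZ := measurable_not_simple.
have -> : P not_simple = (\int[P]_w (\1_not_simple w)%:E)%E.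
  by rewrite integral_indic// setIT.
apply: ge0_le_integral => //.
- by apply/measurable_EFinP; exact: measurable_indic.
- exact/measurable_EFinP.
move=> w _; rewrite lee_fin indicE.
have [|_] := boolP (w \in not_simple); last exact: num_paths_ge0.
rewrite inE => -[i _ Ai]; rewrite /num_paths (bigD1 i)//= indicE mem_set//.
by rewrite lerDl sumr_ge0.
Qed.

Lemma empirical_mean_count t w : ~ not_simple w -> (0 <= t)%E ->
  empirical_mean Ns t w = n%:R^-1 * num_paths (jumped t) w.
Proof.
move=> sw t0; congr (_ * _); apply: eq_bigr => i _.
rewrite -[LHS]/(Defs.path (Ns i) w t) (simple_path_value (cNs i w))//.
by rewrite leNgt; apply/negP => Ai; apply: sw; exists i.
Qed.

End empirical_process.

(** * The norm of the empirical process *)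

Lemma pvar_norm_ge0 (R : realType) (p : R) (f : R -> R) : (0 <= pvar_norm p f)%E.
Proof.
rewrite adde_ge0 ?poweR_ge0//.
apply: (@le_trans _ _ (`|f 0|)%:E); first by rewrite lee_fin.
by apply: ereal_sup_ubound; exists 0 => //=.
Qed.

(** The ratio of the geometric series over the scales; this is where [p < 2]
    enters. *)
Lemma sqrt2_powR_lt1 (R : realType) (p : R) : 0 < p -> p < 2 ->
  Num.sqrt 2 `^ ((p - 2) / p) < 1.
Proof.
move=> p_gt0 p2.
have e_gt0 : 0 < (2 - p) / p by rewrite divr_gt0// subr_gt0.
have one : 1 = 1 `^ ((2 - p) / p) :> R by rewrite powR1.
have sqrt2_gt1 : 1 < Num.sqrt 2 :> R by rewrite -[ltLHS]sqrtr1 ltr_sqrt// ltr1n.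
rewrite -[p - 2]opprB mulNr powRN invf_lt1 ?powR_gt0//.
by rewrite {1}one gt0_ltr_powR ?nnegrE// ltW.
Qed.

Section norm_bound.
Context (R : realType) d0 (T0 : measurableType d0) (P0 : probability T0 R).
Context (N : process P0) d (T : measurableType d) (P : probability T R).
Context (n : nat) (Ns : 'I_n -> process P) (p alpha : R).
Hypothesis cN : counting_process N.
Hypothesis sN : simple_process N.
Hypothesis n_gt0 : (0 < n)%N.
Hypothesis cNs : forall i, counting_process (Ns i).
Hypothesis lawNs : forall i, same_law (Ns i) N.
Hypothesis indNs : independent_processes Ns.
Hypothesis p1 : 1 <= p.
Hypothesis p2 : p < 2.
Hypothesis alpha_gt0 : 0 < alpha.

Let q : R := law N (jumped +oo%E).

Hypothesis alpha_ge : q * n%:R `^ (1 - p) <= alpha `^ p.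

(* lo and hi are the events provided by quantile_cuts. *)
Context (lo hi : nat -> set (\bar R -> R)).
Hypothesis mlo : forall j, <<s @cylinders R >> (lo j).
Hypothesis mhi : forall j, <<s @cylinders R >> (hi j).
Hypothesis lo_hi : forall x j, is_counting_path x -> lo j x -> hi j x.
Hypothesis hi_lo : forall x j, is_counting_path x -> hi j x -> lo j.+1 x.
Hypothesis lo_oo : forall x j, is_counting_path x -> lo j x -> jumped +oo%E x.
Hypothesis lo_cell : forall x (t : R), is_counting_path x -> 0 <= t ->
  lo (cell N n t) x -> jumped t%:E x.
Hypothesis cell_hi : forall x (t : R), is_counting_path x -> 0 <= t ->
  jumped t%:E x -> hi (cell N n t) x.
Hypothesis cell_mass : forall j, j%:R <= n%:R * q ->
  n%:R * (law N (hi j) - law N (lo j)) <= 1.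

Let J := (Num.truncn (n%:R * q)).+1.
Let K := up_log 2 J.
(* The exponent is chosen so that (rho ^+ k) `^ p = c k `^ (p - 2). *)
Let rho : R := Num.sqrt 2 `^ ((p - 2) / p).
Let c k : R := Num.sqrt 2 ^+ k.

(* The b-th increment at scale 2 ^ k in the dyadic chaining of the left ends. *)
Let block k b := lo (b.*2.+1 * 2 ^ k) `\` lo (b.*2 * 2 ^ k).

Let z j w := num_paths Ns (hi j `\` lo j) w + n%:R * law N (hi j `\` lo j).
Let x k b w := num_paths Ns (block k b) w - n%:R * law N (block k b).

(* X bounds the sum over the cells of the p-th powers of the total variation, V
   the sum of the p-th powers of the increments at one scale; B and A are the
   linear substitutes for their p-th roots. *)
Let X w := (n%:R `^ p)^-1 * \sum_(j < J) (z j w + z j w ^+ 2).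
Let V k w := (n%:R `^ p)^-1 *
  \sum_(b < 2 ^ (K - k.+1)) (c k `^ (p - 2) * x k b w ^+ 2 + c k `^ p).
Let B w := alpha * (1 + X w / alpha `^ p).
Let A k w := alpha * rho ^+ k * (1 + V k w / (alpha * rho ^+ k) `^ p).

Let cpath w : is_counting_path (Defs.path N w). Proof. exact: cN. Qed.
Let cpaths i w : is_counting_path (Defs.path (Ns i) w). Proof. exact: cNs. Qed.
Let p_gt0 : 0 < p. Proof. exact: lt_le_trans p1. Qed.
Let n_pos : 0 < n%:R :> R. Proof. by rewrite ltr0n. Qed.
Let sqrt2_gt0 : 0 < Num.sqrt 2 :> R. Proof. by rewrite sqrtr_gt0. Qed.
Let c_gt0 k : 0 < c k. Proof. by rewrite exprn_gt0. Qed.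
Let rho_gt0 : 0 < rho. Proof. exact: powR_gt0. Qed.
Let alpharho_gt0 k : 0 < alpha * rho ^+ k.
Proof. by rewrite mulr_gt0// exprn_gt0. Qed.

Let lo_mono w j j' : (j <= j')%N -> is_counting_path w -> lo j w -> lo j' w.
Proof.
move=> /subnK <- cw lw; elim: (j' - j)%N => [|m /(lo_hi cw)/(hi_lo cw)] //.
Qed.

Let law_lo_mono j j' : (j <= j')%N -> law N (lo j) <= law N (lo j').
Proof. by move=> jj'; apply: law_le => // w; apply: lo_mono. Qed.

Let z_ge0 j w : 0 <= z j w.
Proof. by rewrite addr_ge0 ?num_paths_ge0// mulr_ge0// law_ge0. Qed.

Let X_ge0 w : 0 <= X w.
Proof.
rewrite mulr_ge0 ?invr_ge0 ?powR_ge0// sumr_ge0// => j _.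
by rewrite addr_ge0// sqr_ge0.
Qed.

Let V_ge0 k w : 0 <= V k w.
Proof.
rewrite mulr_ge0 ?invr_ge0 ?powR_ge0// sumr_ge0// => b _.
by rewrite addr_ge0 ?powR_ge0// mulr_ge0 ?powR_ge0 ?sqr_ge0.
Qed.

(** Here [lo j] and [hi j] bracket the value at any time of cell [j], for each
    copy as well as in mean, so that the difference of the two brackets
    dominates both the oscillation and the total variation of [F_n - F] over
    the cell. *)
Lemma pvar_norm_empirical_le w : ~ (not_simple Ns) w ->
  (pvar_norm p
     (fun t : R => (empirical_mean Ns t%:E w - mean_fun N t%:E)%R) <=
   ((B w *+ 3 + \sum_(k < K) A k w *+ 2) *+ 2)%:E)%E.
Proof.
move=> sw.
have ninv : 0 <= n%:R^-1 :> R by rewrite invr_ge0.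
have emp t : 0 <= t ->
    empirical_mean Ns t%:E w = n%:R^-1 * num_paths Ns (jumped t%:E) w.
  by move=> t0; apply: empirical_mean_count.
have mf t : 0 <= t -> mean_fun N t%:E = law N (jumped t%:E).
  by move=> t0; apply: mean_fun_law.
have mjump t : 0 <= t -> <<s @cylinders R >> (jumped t%:E).
  by move=> t0; apply: cylinder_jumped.
apply: (@pvar_norm_le R p J K
  (fun t => empirical_mean Ns t%:E w - mean_fun N t%:E)
  (fun t => empirical_mean Ns t%:E w + mean_fun N t%:E) (cell N n)
  (fun j => n%:R^-1 * num_paths Ns (lo j) w - law N (lo j))
  (fun j => n%:R^-1 * num_paths Ns (lo j) w + law N (lo j))
  (fun j => n%:R^-1 * num_paths Ns (hi j) w + law N (hi j))
  (fun k => A k w) (B w)) => //.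
- exact: up_logP.
- by rewrite mulr_ge0 ?addr_ge0 ?divr_ge0 ?powR_ge0 ?(ltW alpha_gt0).
- move=> k; rewrite mulr_ge0 ?addr_ge0 ?divr_ge0 ?powR_ge0//.
  exact/ltW/alpharho_gt0.
- rewrite mf// law_jumped0// subr0 /empirical_mean big1 ?mulr0// => i _.
  exact: counting_0 (cNs i w).
- by move=> s t s0 st; apply: cell_le.
- by move=> t t0; apply: cell_lt.
- move=> j; rewrite lerD//.
    by rewrite ler_wpM2l// num_paths_le// => i; apply: lo_hi.
  by apply: law_le => // w'; apply: lo_hi.
- move=> t t0; rewrite emp// mf//; apply/andP; split; rewrite lerD//.
  + by rewrite ler_wpM2l// num_paths_le// => i; apply: lo_cell.
  + by apply: law_le => [||w']; [|exact: mjump|apply: lo_cell].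
  + by rewrite ler_wpM2l// num_paths_le// => i; apply: cell_hi.
  + by apply: law_le => [||w']; [exact: mjump| |apply: cell_hi].
- move=> t t0; rewrite emp// mf//; set j := cell N n t.
  have c1 : n%:R^-1 * num_paths Ns (lo j) w <=
      n%:R^-1 * num_paths Ns (jumped t%:E) w.
    by rewrite ler_wpM2l// num_paths_le// => i; apply: lo_cell.
  have c2 : n%:R^-1 * num_paths Ns (jumped t%:E) w <=
      n%:R^-1 * num_paths Ns (hi j) w.
    by rewrite ler_wpM2l// num_paths_le// => i; apply: cell_hi.
  have l1 : law N (lo j) <= law N (jumped t%:E).
    by apply: law_le => [||w']; [|exact: mjump|apply: lo_cell].
  have l2 : law N (jumped t%:E) <= law N (hi j).
    by apply: law_le => [||w']; [exact: mjump| |apply: cell_hi].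
  rewrite ler_norml; apply/andP; split; lra.
- move=> s t s0 st; have t0 := le_trans s0 st.
  rewrite !emp// !mf//.
  have st' : (s%:E <= t%:E)%E by rewrite lee_fin.
  have c1 : n%:R^-1 * num_paths Ns (jumped s%:E) w <=
      n%:R^-1 * num_paths Ns (jumped t%:E) w.
    by rewrite ler_wpM2l// num_paths_le// => i; apply: jumped_le.
  have l1 : law N (jumped s%:E) <= law N (jumped t%:E).
    by apply: law_le => [||w']; [exact: mjump|exact: mjump|apply: jumped_le].
  rewrite ler_norml; apply/andP; split; lra.
- apply: (@le_trans _ _ (X w)); last exact: powR_le_linear.
  apply: le_trans; last first.
    apply: (@sum_powR_le_add_square _ p n%:R J (fun j => z j w)) => //.
    exact: ltW.
  rewrite le_eqVlt; apply/orP; left; apply/eqP; apply: eq_bigr => j _.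
  congr (_ `^ _); rewrite /z num_pathsD; last by move=> i; apply: lo_hi.
  rewrite lawD//; last by move=> w'; apply: lo_hi.
  by field; rewrite pnatr_eq0 -lt0n.
- move=> k kK; apply: (@le_trans _ _ (V k w)); last exact: powR_le_linear.
  apply: le_trans; last first.
    exact: (@sum_powR_le_square _ p n%:R (c k) _ (fun b => x k b w) p1 (ltW p2)).
  rewrite le_eqVlt; apply/orP; left; apply/eqP; apply: eq_bigr => b _.
  have le_b : (b.*2 * 2 ^ k <= b.*2.+1 * 2 ^ k)%N by rewrite leq_mul2r leqnSn orbT.
  congr (`|_| `^ _); rewrite /x /block num_pathsD; last first.
    by move=> i; apply: lo_mono.
  rewrite lawD//; last by move=> w'; apply: lo_mono.
  by field; rewrite pnatr_eq0 -lt0n.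
Qed.

Let q_ge0 : 0 <= q. Proof. exact: law_ge0. Qed.

Let law_lo_le j : law N (lo j) <= q.
Proof.
apply: law_le => [||w] //; last exact: lo_oo.
by apply: cylinder_jumped; rewrite leey.
Qed.

Let alpha_scale : (n%:R `^ p)^-1 * (n%:R * q) <= alpha `^ p.
Proof.
rewrite (le_trans _ alpha_ge)// powRB ?powRr1// ?(gt_eqF n_pos) ?implybT//.
by rewrite le_eqVlt; apply/orP; left; apply/eqP; ring.
Qed.

Let cell_mass_sum : \sum_(j < J) n%:R * law N (hi j `\` lo j) <= n%:R * q.
Proof.
rewrite -mulr_sumr ler_wpM2l//.
have gapE j : law N (hi j `\` lo j) = law N (hi j) - law N (lo j).
  by rewrite lawD// => w; apply: lo_hi.
under eq_bigr do rewrite gapE.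
apply: (@sum_gaps_le _ (fun j => law N (lo j)) (fun j => law N (hi j))) => //.
- by move=> j; apply: law_le => // w; apply: lo_hi.
- by move=> j; apply: law_le => // w; apply: hi_lo.
- exact: law_ge0.
Qed.

(** A cell of mass [m / n] with [m <= 1] contributes [E z = 2 m] and
    [E z^2 <= m + 4 m^2 <= 5 m]. *)
Lemma mean_cells : mean_at_most P B (alpha * 8).
Proof.
have mD j : <<s @cylinders R >> (hi j `\` lo j) by exact: cylinderD.
have term (j : 'I_J) : mean_at_most P (fun w => z j w + z j w ^+ 2)
    (7 * (n%:R * law N (hi j `\` lo j))).
  set m := n%:R * _; have m0 : 0 <= m by rewrite mulr_ge0// law_ge0.
  have m1 : m <= 1.
    rewrite /m lawD//; last by move=> w; apply: lo_hi.
    apply: cell_mass; have := ltn_ord j; rewrite ltnS.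
    by rewrite truncn_ge_nat// mulr_ge0.
  have Ec := mean_count_law lawNs (mD j).
  have Ec2 := mean_count_sq_law lawNs indNs (mD j).
  have cm := mean_at_most_cst P m0.
  have cm2 := mean_at_most_cst P (sqr_ge0 m).
  have m2 : 0 <= m *+ 2 by rewrite mulrn_wge0.
  have := mean_at_mostD (mean_at_mostD Ec cm)
    (mean_at_mostD (mean_at_mostD Ec2 (mean_at_mostM m2 Ec)) cm2).
  move=> /mean_at_most_le h; apply: mean_at_most_ext; last apply: h.
  - by move=> w; rewrite /z -/m /=; ring.
  - rewrite -/m; have : m ^+ 2 <= m by rewrite expr2 ler_piMr.
    by move=> mm; nra.
have n0 : 0 <= (n%:R `^ p)^-1 :> R by rewrite invr_ge0 powR_ge0.
have ap : 0 <= (alpha `^ p)^-1 by rewrite invr_ge0 powR_ge0.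
have := mean_at_mostM n0 (mean_at_most_sum term).
move=> /(mean_at_mostM ap)/(mean_at_mostD (mean_at_most_cst P ler01)).
move=> /(mean_at_mostM (ltW alpha_gt0))/mean_at_most_le h.
apply: mean_at_most_ext; last apply: h.
  by move=> w; rewrite /B /X [_ / alpha `^ p]mulrC.
rewrite ler_wpM2l ?(ltW alpha_gt0)// (_ : 8 = 1 + 7); last by ring.
rewrite lerD2l -mulr_sumr mulrC ler_pdivrMr ?powR_gt0//.
rewrite mulrCA ler_wpM2l//; apply: le_trans alpha_scale.
by rewrite ler_wpM2l.
Qed.

(** With [c = 2^(k/2)] the two terms of the bound [c^(p-2) x^2 + c^p] balance:
    the squares add up to the total mass [n q] in mean, and the number of
    increments at scale [2^k] is at most [n q / c^2], because there are at most
    [n q + 1] cells. When [n q < 1] there is one cell and no scale at all, so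
    the bound stays proportional to [q]. *)
Lemma mean_level k : (k < K)%N -> mean_at_most P (A k) (alpha * rho ^+ k * 3).
Proof.
move=> kK.
have mD b : <<s @cylinders R >> (block k b) by exact: cylinderD.
pose m b := n%:R * law N (block k b).
have term (b : 'I_(2 ^ (K - k.+1))) : mean_at_most P
    (fun w => c k `^ (p - 2) * x k b w ^+ 2 + c k `^ p)
    (c k `^ (p - 2) * m b + c k `^ p).
  apply: mean_at_mostD; last exact/mean_at_most_cst/powR_ge0.
  apply: mean_at_mostM; first exact: powR_ge0.
  exact: (mean_count_centered_sq_law lawNs indNs (mD b)).
have n0 : 0 <= (n%:R `^ p)^-1 :> R by rewrite invr_ge0 powR_ge0.
pose a := alpha * rho ^+ k.
have ap : 0 <= (a `^ p)^-1 by rewrite invr_ge0 powR_ge0.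
have := mean_at_mostM n0 (mean_at_most_sum term).
move=> /(mean_at_mostM ap)/(mean_at_mostD (mean_at_most_cst P ler01)).
move=> /(mean_at_mostM (ltW (alpharho_gt0 k)))/mean_at_most_le h.
apply: mean_at_most_ext; last apply: h.
  by move=> w; rewrite /A /V [_ / _ `^ p]mulrC.
rewrite -/a ler_wpM2l ?(ltW (alpharho_gt0 k))// (_ : 3 = 1 + 2); last by ring.
rewrite lerD2l mulrC ler_pdivrMr ?powR_gt0 ?alpharho_gt0//.
have c2 : c k ^+ 2 = 2 ^+ k.
  by rewrite /c exprAC sqr_sqrtr.
have cp : c k `^ p = c k `^ (p - 2) * 2 ^+ k.
  rewrite -c2 -powR_mulrn ?(ltW (c_gt0 k))// -powRD ?subrK//.
  by rewrite (gt_eqF (c_gt0 k)) implybT.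
have rhop : (rho ^+ k) `^ p = c k `^ (p - 2).
  rewrite powR_exprn ?(ltW rho_gt0)// /rho -powRrM divfK ?gt_eqF//.
  by rewrite -powR_exprn ?(ltW sqrt2_gt0).
have masses : \sum_(b < 2 ^ (K - k.+1)) m b <= n%:R * q.
  rewrite -mulr_sumr ler_wpM2l//.
  have le_b b : (b.*2 * 2 ^ k <= b.*2.+1 * 2 ^ k)%N by rewrite leq_mul2r leqnSn orbT.
  have gapE b : law N (block k b) =
      law N (lo (b.*2.+1 * 2 ^ k)) - law N (lo (b.*2 * 2 ^ k)).
    by rewrite lawD// => w; apply: lo_mono.
  under eq_bigr do rewrite gapE.
  apply: (@sum_gaps_le _ (fun b => law N (lo (b.*2 * 2 ^ k)))
    (fun b => law N (lo (b.*2.+1 * 2 ^ k)))) => //.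
  - by move=> b; apply: law_lo_mono.
  - by move=> b; apply: law_lo_mono; rewrite leq_mul2r doubleS leqnSn orbT.
  - exact: law_ge0.
have number : (2 ^ (K - k.+1))%:R * 2 ^+ k <= n%:R * q.
  rewrite -[2 ^+ k]natrX -natrM -expnD.
  have -> : (K - k.+1 + k = K.-1)%N by rewrite -[in RHS](subnK kK) addnS.
  apply: (@le_trans _ _ (Num.truncn (n%:R * q))%:R); last first.
    by have /andP[] := truncn_itv (mulr_ge0 (ltW n_pos) q_ge0).
  (* K is the least exponent with J <= 2 ^ K. *)
  rewrite ler_nat -ltnS -/J ltnNge; apply/negP => /(up_log_min (ltnSn 1)).
  by rewrite -/K -ltnS prednK ?ltnn// (leq_ltn_trans _ kK).
rewrite big_split /= -mulr_sumr sumr_const card_ord -[c k `^ p *+ _]mulr_natl.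
have rhok0 : 0 <= rho ^+ k by rewrite exprn_ge0// ltW.
rewrite cp /a (powRM p (ltW alpha_gt0) rhok0) rhop.
rewrite [X in _ * (_ + X)]mulrCA -mulrDr.
rewrite [leLHS]mulrCA.
rewrite [leRHS](_ : _ = c k `^ (p - 2) * (2 * alpha `^ p)); last by ring.
rewrite ler_wpM2l ?powR_ge0//.
apply: (@le_trans _ _ ((n%:R `^ p)^-1 * (2 * (n%:R * q)))).
  by rewrite ler_wpM2l// (_ : 2 * _ = n%:R * q + n%:R * q) ?lerD//; ring.
by rewrite mulrCA ler_wpM2l.
Qed.

Lemma mean_pvar_norm_le :
  (\int[P]_w pvar_norm p
     (fun t : R => (empirical_mean Ns t%:E w - mean_fun N t%:E)%R)
   <= (alpha * (48 + 12 / (1 - rho)))%:E)%E.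
Proof.
have mZ : measurable (not_simple Ns) by exact: measurable_not_simple.
have PZ : P (not_simple Ns) = 0%E by exact: not_simple_null sN lawNs.
have levels := mean_at_most_sum (fun k : 'I_K => mean_level (ltn_ord k)).
have := mean_at_mostD (mean_at_mostM (ler0n _ 3) mean_cells)
  (mean_at_mostM (ler0n _ 2) levels).
move=> /(mean_at_mostM (ler0n _ 2)) [mg g0 Eg].
apply: le_trans.
  apply: (le_integral_ae _ g0 mg mZ PZ).
  - by move=> w; exact: pvar_norm_ge0.
  - move=> w sw; apply: le_trans (pvar_norm_empirical_le sw) _.
    rewrite lee_fin le_eqVlt; apply/orP; left; apply/eqP.
    by rewrite sumrMnl; ring.
apply: (le_trans Eg); rewrite lee_fin.
rewrite -mulr_suml -mulr_sumr.
have := sum_geometric_le K rho_gt0 (sqrt2_powR_lt1 p_gt0 p2).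
set S := \sum_(k < K) _ => hS.
rewrite [leLHS](_ : _ = alpha * (48 + 12 * S)); last by ring.
by rewrite ler_wpM2l ?(ltW alpha_gt0)// lerD2l ler_wpM2l.
Qed.

End norm_bound.

Theorem theorem2 (R : realType) (p : R) (hp1 : 1 <= p) (hp2 : p < 2) :
  exists K : R,
    forall (d0 : measure_display) (T0 : measurableType d0)
           (P0 : probability T0 R) (N : process P0),
      counting_process N -> simple_process N ->
    forall (d : measure_display) (T : measurableType d)
           (P : probability T R) (n : nat) (Ns : 'I_n -> process P),
      (0 < n)%N ->
      (forall i, counting_process (Ns i)) ->
      (forall i, same_law (Ns i) N) ->
      independent_processes Ns ->
      (\int[P]_w pvar_norm p
         (fun t : R => (empirical_mean Ns t%:E w - mean_fun N t%:E)%R)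
       <= (K * mean_fun N +oo%E `^ p^-1 * n%:R `^ ((1 - p) / p))%R%:E)%E.
Proof.
have p_gt0 : 0 < p by exact: lt_le_trans hp1.
pose rho : R := Num.sqrt 2 `^ ((p - 2) / p).
have rho1 : rho < 1 by exact: sqrt2_powR_lt1.
pose C := 48 + 12 / (1 - rho).
have C_gt0 : 0 < C by rewrite addr_gt0// divr_gt0// subr_gt0.
exists C => d0 T0 P0 N cN sN d T P n Ns n_gt0 cNs lawNs indNs.
have [lo [hi [mlh nest lo_oo cellP gap]]] := quantile_cuts cN n_gt0.
rewrite mean_fun_law ?leey//; set q := law N _.
have q0 : 0 <= q by exact: law_ge0.
pose a0 := q `^ p^-1 * n%:R `^ ((1 - p) / p).
have a0_ge0 : 0 <= a0 by rewrite mulr_ge0 ?powR_ge0.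
have a0p : a0 `^ p = q * n%:R `^ (1 - p).
  by rewrite powRM ?powR_ge0// -!powRrM mulVf ?gt_eqF// divfK ?gt_eqF// powRr1.
rewrite -mulrA -/a0; apply/lee_addgt0Pr => e e0.
(* a0 vanishes when q does, hence the slack e. *)
pose alpha := a0 + e / C.
have alpha0 : 0 < alpha by rewrite ltr_wpDl// divr_gt0.
have alpha_ge : q * n%:R `^ (1 - p) <= alpha `^ p.
  rewrite -a0p ge0_ler_powR ?nnegrE ?(ltW p_gt0) ?(ltW alpha0)//.
  by rewrite lerDl divr_ge0 ?ltW.
have -> : ((C * a0)%:E + e%:E)%E = (alpha * C)%:E.
  by rewrite -EFinD; congr _%:E; rewrite /alpha; field; rewrite gt_eqF.
apply: (@mean_pvar_norm_le R d0 T0 P0 N d T P n Ns p alpha cN sN n_gt0 cNs lawNs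
  indNs hp1 hp2 alpha0 alpha_ge lo hi) => //.
- by move=> j; have [] := mlh j.
- by move=> j; have [] := mlh j.
- by move=> x j cx; have [] := nest x j cx.
- by move=> x j cx; have [] := nest x j cx.
- by move=> x t cx t0; have [] := cellP x t cx t0.
- by move=> x t cx t0; have [] := cellP x t cx t0.
Qed.
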